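(* Let $\alpha\in\mathbb{Q}\setminus\{0,1,-1\}$. Consider the two Legendre elliptic curves over $\mathbb{Q}$ $$E_1:\ y^2=x(x-1)\left(x-\frac{2(1+\alpha^4)}{(-1+\alpha^2)^2}\right),\qquad E_2:\ y^2=x(x-1)\left(x+\frac{(-1+\alpha^2)^2}{4\alpha^2}\right),$$ and set $$g_\alpha(t)=-(t^4+4)\left((\alpha^2-1)^2t^4+4(\alpha^2+1)^2t^2+4(\alpha^2-1)^2\right)\left(\alpha^2t^4-(\alpha^2+1)^2t^2+4\alpha^2\right).$$ Then for all but finitely many rational points $(t,u)\in\mathbb{Q}^2$ on the curve $u^2=\alpha^2t^4-(\alpha^2+1)^2t^2+4\alpha^2$, the quadratic twists $E_1^{g_\alpha(t)}$ and $E_2^{g_\alpha(t)}$ both have Mordell-Weil rank at least $2$ over $\mathbb{Q}$. Moreover, for all but finitely many such $(t,u)$, the points $$\left(-\frac{t^4(-1+\alpha^2)^2+4t^2(1+\alpha^2)^2+4(-1+\alpha^2)^2}{4u^2},\ \frac{(t^2-2)(\alpha^2+1)^3}{8(\alpha^2-1)u^4}\right),\qquad \left(-\frac{(t^2-2)^2}{4t^2},\ \frac{t^2-2}{8t^3(\alpha^2-1)u}\right)$$ are two independent points of infinite order in $E_1^{g_\alpha(t)}(\mathbb{Q})$, and the points $$\left(-\frac{t^4(-1+\alpha^2)^2+4t^2(1+\alpha^2)^2+4(-1+\alpha^2)^2}{4u^2},\ \frac{t(\alpha^2+1)^3}{8\alpha u^4}\right),\qquad \left(\frac{4t^2}{(t^2+2)^2},\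 \frac{t}{(t^2+2)^3\alpha u}\right)$$ are two independent points of infinite order in $E_2^{g_\alpha(t)}(\mathbb{Q})$.
   Context: For an elliptic curve $E: y^2=f(x)$ over $\mathbb{Q}$ and a nonzero $d\in\mathbb{Q}$, the quadratic twist of $E$ by $d$ is the curve $E^d:\ d\,y^2=f(x)$; coordinates of points on $E^d$ are with respect to this equation. A Legendre elliptic curve is one given by $y^2=x(x-1)(x-\lambda)$ with $\lambda\in\mathbb{Q}\setminus\{0,1\}$. Independent means linearly independent over $\mathbb{Z}$ in the Mordell-Weil group. *)

(* Defs.v *)
From mathcomp Require Import all_boot all_order all_algebra.
From mathcomp Require Import ring lra.
Set Implicit Arguments.
Unset Strict Implicit.
Unset Printing Implicit Defensive.
Import Order.TTheory GRing.Theory Num.Theory.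
Local Open Scope ring_scope.

(* A rational point of the projective closure of d y^2 = f(x), where f is a
   monic cubic; [Inf] is the point at infinity. *)
Inductive ec_point := Inf | Aff of rat & rat.

Section MordellWeil.

(* The twist E^d : d y^2 = f(x) of E : y^2 = f(x).  The definitions below are
   the Mordell-Weil group of E^d when d is nonzero and f is a monic separable
   cubic. *)
Variables (d : rat) (f : {poly rat}).

Definition on_twist (P : ec_point) : Prop :=
  if P is Aff x y then d * y ^+ 2 = f.[x] else True.

Definition ec_opp (P : ec_point) : ec_point :=
  if P is Aff x y then Aff x (- y) else Inf.

(* Third point of the line of slope m through (x1, y1), reflected in the x-axis:
   substituting the line into d y^2 = f(x) gives a monic cubic whose three
   roots sum to d m^2 - f`_2. *)
Definition ec_chord (m x1 y1 x2 : rat) : ec_point :=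
  let x3 := d * m ^+ 2 - f`_2 - x1 - x2 in
  Aff x3 (- (y1 + m * (x3 - x1))).

Definition ec_add (P Q : ec_point) : ec_point :=
  match P, Q with
  | Inf, _ => Q
  | _, Inf => P
  | Aff x1 y1, Aff x2 y2 =>
      if x1 != x2 then ec_chord ((y2 - y1) / (x2 - x1)) x1 y1 x2
      else if y1 + y2 == 0 then Inf
      else ec_chord (f^`().[x1] / (2 * d * y1)) x1 y1 x2
  end.

Definition ec_muln (n : nat) (P : ec_point) : ec_point := iter n (ec_add P) Inf.

Definition ec_mulz (n : int) (P : ec_point) : ec_point :=
  match n with
  | Posz k => ec_muln k P
  | Negz k => ec_opp (ec_muln k.+1 P)
  end.

Definition infinite_order (P : ec_point) : Prop :=
  forall n : nat, (0 < n)%N -> ec_muln n P <> Inf.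

Definition independent (r : nat) (P : r.-tuple ec_point) : Prop :=
  forall n : 'I_r -> int,
    \big[ec_add/Inf]_(i < r) ec_mulz (n i) (tnth P i) = Inf ->
    forall i, n i = 0.

Definition rank_ge (r : nat) : Prop :=
  exists P : r.-tuple ec_point,
    (forall i, on_twist (tnth P i)) /\ independent P.

Definition independent_points_of_infinite_order (P Q : ec_point) : Prop :=
  [/\ on_twist P, on_twist Q, infinite_order P, infinite_order Q
    & independent [tuple P; Q]].

End MordellWeil.

Definition legendre (l : rat) : {poly rat} := 'X * ('X - 1) * ('X - l%:P).

Definition lambda1 (a : rat) : rat :=
  2 * (1 + a ^+ 4) / (-1 + a ^+ 2) ^+ 2.

Definition lambda2 (a : rat) : rat :=
  - ((-1 + a ^+ 2) ^+ 2 / (4 * a ^+ 2)).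

Definition E1 (a : rat) : {poly rat} := legendre (lambda1 a).
Definition E2 (a : rat) : {poly rat} := legendre (lambda2 a).

Definition quartic (a t : rat) : rat :=
  a ^+ 2 * t ^+ 4 - (a ^+ 2 + 1) ^+ 2 * t ^+ 2 + 4 * a ^+ 2.

Definition g (a t : rat) : rat :=
  - (t ^+ 4 + 4)
  * ((a ^+ 2 - 1) ^+ 2 * t ^+ 4 + 4 * (a ^+ 2 + 1) ^+ 2 * t ^+ 2
     + 4 * (a ^+ 2 - 1) ^+ 2)
  * quartic a t.

Definition P0 (a t u : rat) : rat :=
  - ((t ^+ 4 * (-1 + a ^+ 2) ^+ 2 + 4 * t ^+ 2 * (1 + a ^+ 2) ^+ 2
      + 4 * (-1 + a ^+ 2) ^+ 2) / (4 * u ^+ 2)).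

Definition P1 (a t u : rat) : ec_point :=
  Aff (P0 a t u)
      ((t ^+ 2 - 2) * (a ^+ 2 + 1) ^+ 3 / (8 * (a ^+ 2 - 1) * u ^+ 4)).

Definition Q1 (a t u : rat) : ec_point :=
  Aff (- ((t ^+ 2 - 2) ^+ 2 / (4 * t ^+ 2)))
      ((t ^+ 2 - 2) / (8 * t ^+ 3 * (a ^+ 2 - 1) * u)).

Definition P2 (a t u : rat) : ec_point :=
  Aff (P0 a t u) (t * (a ^+ 2 + 1) ^+ 3 / (8 * a * u ^+ 4)).

Definition Q2 (a t u : rat) : ec_point :=
  Aff (4 * t ^+ 2 / (t ^+ 2 + 2) ^+ 2)
      (t / ((t ^+ 2 + 2) ^+ 3 * a * u)).

(* E1 and E2 are nonsingular for the parameters considered. *)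
Lemma lambda1_neq01 (a : rat) :
  a != 1 -> a != -1 -> (lambda1 a != 0) && (lambda1 a != 1).
Proof.
move=> a1 aN1.
have h : (-1 + a ^+ 2) ^+ 2 != 0.
  rewrite expf_neq0 // [X in X != _](_ : _ = (a - 1) * (a + 1)); last by ring.
  by rewrite mulf_neq0 ?subr_eq0 // addr_eq0.
have a2 : 0 <= a ^+ 2 by exact: sqr_ge0.
have a4 : 0 <= a ^+ 4 by rewrite (exprM a 2 2) sqr_ge0.
apply/andP; split.
  by rewrite mulf_neq0 ?invr_neq0 // lt0r_neq0 //; lra.
have k : -1 + a ^+ 2 != 0 by apply: contraNneq h => ->; rewrite expr0n.
have -> : lambda1 a = 1 + (a ^+ 4 + 2 * a ^+ 2 + 1) / (-1 + a ^+ 2) ^+ 2.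
  by rewrite /lambda1; field.
rewrite -subr_eq0 addrC addKr mulf_neq0 ?invr_neq0 //.
by rewrite lt0r_neq0 //; lra.
Qed.

Lemma lambda2_neq01 (a : rat) :
  a != 0 -> a != 1 -> a != -1 -> (lambda2 a != 0) && (lambda2 a != 1).
Proof.
move=> a0 a1 aN1.
have h : (-1 + a ^+ 2) ^+ 2 != 0.
  rewrite expf_neq0 // [X in X != _](_ : _ = (a - 1) * (a + 1)); last by ring.
  by rewrite mulf_neq0 ?subr_eq0 // addr_eq0.
have k : 4 * a ^+ 2 != 0 by rewrite mulf_neq0 ?expf_neq0.
apply/andP; split; first by rewrite oppr_eq0 mulf_neq0 ?invr_neq0.
have : lambda2 a <= 0.
  by rewrite oppr_le0 divr_ge0 ?sqr_ge0 // mulr_ge0 ?sqr_ge0.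
by move=> le0; apply/eqP=> e; rewrite e in le0.
Qed.

(* Main.v *)
Require Import Defs.
From HB Require Import structures.
From mathcomp Require Import all_boot all_order all_algebra.
From mathcomp Require Import algC.
From mathcomp Require Import ring lra zify.
Set Implicit Arguments.
Unset Strict Implicit.
Unset Printing Implicit Defensive.
Import Order.TTheory GRing.Theory Num.Theory.
Local Open Scope ring_scope.

(** The curves [E1] and [E2] do not depend on [t]: only the twist does.  On all
    the twists of a fixed Legendre curve the logarithmic height of the
    x-coordinate satisfies the parallelogram law up to one and the same
    constant ([log_height_quasi_quadratic]).  Linear independence can therefore
    be read off from heights, uniformly in [t].

    Put [w = t^2 + 4 / t^2].  The x-coordinates of both given points are
    homographies in [w] with rational coefficients, so they are images of each
    other under a fixed homography and the two points [P], [Q] have the same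
    height up to a constant ([log_height_moebius]).  A relation [m P + n Q = 0]
    then gives [m^2 h(Q) = n^2 h(Q) + O(m^2 + n^2)], so for large [h(Q)] the
    integers [m] and [n] are nearly equal up to sign, and
    [m (P + Q) = (m - n) Q] (or [m (P - Q) = - (m + n) Q]) bounds the height of
    [P + Q] (or of [P - Q]).  This is [quasi_independent]: the points are
    independent as soon as the heights of [Q], [P + Q] and [P - Q] exceed a
    constant.

    By Northcott's finiteness property [finite_height_le], it remains to see
    that these three points take a given x-coordinate for finitely many [t]
    only.  The x-coordinates of [P + Q] and [P - Q] are the roots of a
    quadratic form whose coefficients are polynomials in [w] ([xsum]); for
    fixed roots this is a polynomial equation in [w], and it is not trivial,
    as its values at two well chosen [w] show ([E1_xsum_poly_neq0],
    [E2_xsum_poly_neq0]).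

    The group law is needed for the relation on [m (P + Q)].  Associativity
    ([collinear_assoc]) is proved by an explicit description of the line
    through [P], [Q + R] and [- (P + Q + R)].  The parallelogram law comes from
    an upper bound for [h(A + B) + h(A - B)] ([height_add_sub]), and from the
    lower bound [4 h(A) - O(1)] for [h(2A)] ([duplication_gcd]), which turns
    the upper bound for [A + B], [A - B] into a lower one. *)

(** * Collinear triples on a twisted cubic and associativity *)

Definition cubic (a b c : rat) : {poly rat} :=
  'X^3 + a%:P * 'X^2 + b%:P * 'X + c%:P.

Lemma horner_cubic a b c x : (cubic a b c).[x] = x ^+ 3 + a * x ^+ 2 + b * x + c.
Proof. by rewrite /cubic !hornerE. Qed.

Lemma coef2_cubic a b c : (cubic a b c)`_2 = a.
Proof. by rewrite /cubic !coefE /=; ring. Qed.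

Lemma deriv_cubic a b c x :
  (cubic a b c)^`().[x] = 3 * x ^+ 2 + 2 * a * x + b.
Proof. by rewrite /cubic !derivE !hornerE /=; ring. Qed.

(** For a cubic, having no multiple rational root; this is all that the group
    law on rational points needs. *)
Definition nonsingular (f : {poly rat}) := forall x, f.[x] = 0 -> f^`().[x] != 0.

Section Collinear.
Variables (d a b c : rat).
Hypothesis d_neq0 : d != 0.
Let f := cubic a b c.
Hypothesis f_nonsing : nonsingular f.

(** The three affine points lie on a line [y = m x + k] that meets the curve
    [d y^2 = x^3 + a x^2 + b x + c] exactly in them, with multiplicity: the
    first three equations state the equality of polynomials
    [f - d (m X + k)^2 = (X - x1) (X - x2) (X - x3)].  Tangent lines need no
    separate treatment. *)
Definition collinear (x1 y1 x2 y2 x3 y3 : rat) : Prop := exists m k : rat,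
  [/\ d * m ^+ 2 - a = x1 + x2 + x3,
      b - 2 * d * m * k = x1 * x2 + x1 * x3 + x2 * x3,
      c - d * k ^+ 2 = - (x1 * x2 * x3)
    & [/\ y1 = m * x1 + k, y2 = m * x2 + k & y3 = m * x3 + k]].

Lemma collinear_rot x1 y1 x2 y2 x3 y3 :
  collinear x1 y1 x2 y2 x3 y3 -> collinear x2 y2 x3 y3 x1 y1.
Proof.
case=> m [k [e1 e2 e3 [h1 h2 h3]]]; exists m, k.
by split=> //; rewrite ?e1 ?e2 ?e3; ring.
Qed.

Lemma collinear_swap x1 y1 x2 y2 x3 y3 :
  collinear x1 y1 x2 y2 x3 y3 -> collinear x2 y2 x1 y1 x3 y3.
Proof.
case=> m [k [e1 e2 e3 [h1 h2 h3]]]; exists m, k.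
by split=> //; rewrite ?e1 ?e2 ?e3; ring.
Qed.

Lemma collinear_opp x1 y1 x2 y2 x3 y3 :
  collinear x1 y1 x2 y2 x3 y3 -> collinear x1 (- y1) x2 (- y2) x3 (- y3).
Proof.
case=> m [k [e1 e2 e3 [h1 h2 h3]]]; exists (- m), (- k).
split; rewrite -?e1 -?e2 -?e3; try ring.
by split; rewrite ?h1 ?h2 ?h3; ring.
Qed.

Lemma collinear_on x1 y1 x2 y2 x3 y3 :
  collinear x1 y1 x2 y2 x3 y3 -> on_twist d f (Aff x1 y1).
Proof.
case=> m [k [e1 e2 e3 [-> _ _]]]; rewrite /= horner_cubic.
have -> : a = d * m ^+ 2 - (x1 + x2 + x3) by rewrite -e1; ring.
have -> : b = 2 * d * m * k + (x1 * x2 + x1 * x3 + x2 * x3) by rewrite -e2; ring.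
have -> : c = d * k ^+ 2 - x1 * x2 * x3 by rewrite -[in RHS](opprK (_ * _)) -e3; ring.
ring.
Qed.

(** For [x1 = x2] or [x1 = x3], the line is tangent to the curve at the point
    [(x1, y1)]. *)
Lemma collinear_slope x1 y1 x2 x3 m k :
  d * m ^+ 2 - a = x1 + x2 + x3 ->
  b - 2 * d * m * k = x1 * x2 + x1 * x3 + x2 * x3 ->
  y1 = m * x1 + k ->
  f^`().[x1] - 2 * d * m * y1 = (x1 - x2) * (x1 - x3).
Proof.
move=> e1 e2 ->; rewrite deriv_cubic.
have -> : a = d * m ^+ 2 - (x1 + x2 + x3) by rewrite -e1; ring.
have -> : b = 2 * d * m * k + (x1 * x2 + x1 * x3 + x2 * x3) by rewrite -e2; ring.
ring.
Qed.

(** With [A = P + Q], [S = A + R] and [B = Q + R], the points [P], [B] and [- S]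
    are collinear.  Writing [L1], [L2], [L3] for the three given lines, the
    function [(y - L1) (y - L2) / (x - A)] is regular on the affine curve; its
    product with [y + L3] is divisible by [(x - q) (x - r)], and the quotient
    vanishes on the line [L4 = M (x - B) - L3], where [M = m1 + m2]. *)
Lemma collinear_assoc p yp q yq r yr A yA s ys B yB :
  collinear p yp q yq A (- yA) -> collinear A yA r yr s (- ys) ->
  collinear q yq r yr B (- yB) -> collinear p yp B yB s (- ys).
Proof.
move=> c1 c2 c3; have onQ := collinear_on c3; move: c1 c2 c3.
case=> m1 [k1 [a1 b1 _ [p1 q1 A1]]].
case=> m2 [k2 [a2 b2 _ [A2 r2 s2]]].
case=> m3 [k3 [a3 b3 c3 [q3 r3 B3]]].
set M := m1 + m2.
(* L1 and L2 take opposite values at A, so L1 + L2 = M (X - A). *)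
have kA : k1 + k2 = - M * A by rewrite /M; lra.
(* g1 and g0 compare coefficients in
   (X - p) (X - q) + d M L1 = (X - r) (X - s) + d M L2. *)
have g1 : d * M * (m1 - m2) = p + q - r - s
  by rewrite /M; lra.
have g0 : p * q - r * s = - (d * M * (k1 - k2)).
  have -> : p * q - r * s = - (2 * d * m1 * k1 - 2 * d * m2 * k2)
      + (- M * A) * (d * (m1 - m2)).
    by have := congr1 ( *%R A) g1; lra.
  by rewrite -kA /M; ring.
(* Equivalently, (X - p) (X - q) + d M (L1 - L3) = (X - q) (X - r): both sides
   are monic and vanish at q and r; if q = r, the line L3 is tangent at Q. *)
have key : p - r = d * M * (m1 - m3).
  have [eqr|neqr] := eqVneq q r; last first.
    have nz : r - q != 0 by rewrite subr_eq0 eq_sym.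
    apply: (mulIf nz).
    have E : (m1 - m3) * (r - q) = m1 * r + k1 - yr by rewrite r3; lra.
    have := congr1 ( *%R (d * M)) E; have := congr1 ( *%R r) g1.
    by rewrite r2; lra.
  subst r.
  have t1 : f^`().[q] - 2 * d * m1 * yq = (q - p) * (q - A).
    by apply: (collinear_slope (k := k1)); rewrite // ?a1 ?b1; ring.
  have t3 : f^`().[q] - 2 * d * m3 * yq = (q - q) * (q - B).
    by apply: (collinear_slope (k := k3)); rewrite // ?a3 ?b3; ring.
  have E : 2 * yq = M * (q - A) by rewrite /M; lra.
  have nz : q - A != 0.
    apply/eqP=> z; have y0 : yq = 0 by move: E; rewrite z mulr0; lra.
    have fq : f.[q] = 0 by rewrite -onQ y0; ring.
    by have /eqP := f_nonsing fq; apply; move: t1; rewrite z y0 mulr0; lra.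
  apply: (mulIf nz).
  by have := congr1 ( *%R (d * (m1 - m3))) E; lra.
have key2 : s - q = d * M * (m2 - m3) by lra.
(* w1 and w0 compare coefficients in
   (X - q) (X - r) + 2 d M L3 - d M^2 (X - B) = (X - p) (X - s). *)
have w1 : p + s = q + r - 2 * d * M * m3 + d * M ^+ 2.
  have -> : d * M ^+ 2 = d * M * m1 + d * M * m2 by rewrite /M; ring.
  by lra.
have w0 : p * s = q * r + 2 * d * M * k3 + d * M ^+ 2 * B.
  have BA : B - A = d * (m3 - m1) * (m3 - m2) by rewrite /M in w1; lra.
  have -> : p * s = (r + d * M * (m1 - m3)) * (q + d * M * (m2 - m3)).
    by rewrite -key -key2; ring.
  have -> : B = A + d * (m3 - m1) * (m3 - m2) by rewrite -BA; ring.
  have E1 : (m1 - m3) * q = k3 - k1 by lra.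
  have E2 : (m2 - m3) * r = k3 - k2 by lra.
  have E3 : M * A = - (k1 + k2) by rewrite kA; ring.
  transitivity (q * r + d * M * ((m1 - m3) * q + (m2 - m3) * r)
     + d ^+ 2 * M ^+ 2 * (m1 - m3) * (m2 - m3)); first by ring.
  rewrite E1 E2.
  transitivity (q * r + 2 * d * M * k3 + d * M * (M * A)
     + d ^+ 2 * M ^+ 2 * (m1 - m3) * (m2 - m3)); first by rewrite E3; ring.
  by ring.
exists (M - m3), (- M * B - k3).
(* If M = 0, then L2 = - L1, so that P and R, as well as Q and S, have the
   same x-coordinate. *)
have [M0|M0] := eqVneq M 0.
  rewrite M0 in g1 g0 key key2 w1 w0 kA *.
  have pr : p = r by lra.
  have sq : s = q by lra.
  subst p s; have m21 : m2 = - m1 by rewrite /M in M0; lra.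
  have k21 : k2 = - k1 by lra.
  by rewrite m21 k21 in r2 s2; split; [lra|lra|lra|split; lra].
split.
- by lra.
- by have := congr1 ( *%R B) w1; lra.
- have -> : c - d * (- M * B - k3) ^+ 2 = c - d * k3 ^+ 2
     - B * (d * M ^+ 2 * B + 2 * d * M * k3) by ring.
  have -> : d * M ^+ 2 * B + 2 * d * M * k3 = p * s - q * r by rewrite w0; ring.
  by rewrite c3; ring.
have nz : d * M != 0 by rewrite mulf_neq0.
split.
- have E : (m1 - m3) * (p - q) = yp - (m3 * p + k3) by rewrite p1; lra.
  apply: (mulfI nz); have := congr1 ( *%R (d * M)) E.
  by have := congr1 ( *%R (p - q)) key; have := congr1 ( *%R p) w1; lra.
- by lra.
- have E : (m2 - m3) * (s - r) = - ys - (m3 * s + k3) by rewrite s2; lra.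
  apply: (mulfI nz); have := congr1 ( *%R (d * M)) E.
  by have := congr1 ( *%R (s - r)) key2; have := congr1 ( *%R s) w1; lra.
Qed.

End Collinear.

(** * The Mordell-Weil group *)

Section GroupLaw.
Variables (d a b c : rat).
Hypothesis d_neq0 : d != 0.
Let f := cubic a b c.
Hypothesis f_nonsing : nonsingular f.
Local Notation collinear := (collinear d a b c).

Lemma collinear_add x1 y1 x2 y2 x3 y3 :
  collinear x1 y1 x2 y2 x3 y3 ->
  ec_add d f (Aff x1 y1) (Aff x2 y2) = Aff x3 (- y3).
Proof.
move=> cl; have on1 := collinear_on cl.
case: cl => m [k [e1 e2 e3 [h1 h2 h3]]].
suff chord n : n = m -> ec_chord d f n x1 y1 x2 = Aff x3 (- y3).
  rewrite /=; case: eqVneq => [eq12|neq12] /=; last first.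
    by apply: chord; rewrite h1 h2; field; rewrite subr_eq0 eq_sym.
  have eqy : y2 = y1 by rewrite h2 h1 eq12.
  have sl : f^`().[x1] = 2 * d * m * y1.
    apply/eqP; rewrite -subr_eq0; apply/eqP.
    have -> := collinear_slope c e1 e2 h1.
    by rewrite eq12 subrr mul0r.
  have y10 : y1 != 0.
    apply/eqP=> y0; have f0 : f.[x1] = 0 by rewrite -on1 y0; ring.
    by have /eqP := f_nonsing f0; apply; rewrite sl y0 mulr0.
  rewrite eqy -mulr2n mulrn_eq0 /= (negPf y10).
  by apply: chord; rewrite sl; field; rewrite y10.
move=> ->; rewrite /ec_chord coef2_cubic e1.
have -> : x1 + x2 + x3 - x1 - x2 = x3 by ring.
by congr Aff; rewrite h1 h3; ring.
Qed.

(** The line is the chord or the tangent; its third point may coincide with one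
    of the other two. *)
Lemma collinear_exists x1 y1 x2 y2 :
  on_twist d f (Aff x1 y1) -> on_twist d f (Aff x2 y2) ->
  (x1 != x2) || (y1 + y2 != 0) ->
  exists x3 y3, collinear x1 y1 x2 y2 x3 y3.
Proof.
rewrite /= !horner_cubic => on1 on2.
suff ex m : y2 = y1 + m * (x2 - x1) ->
    b - 2 * d * m * (y1 - m * x1) =
       x1 * x2 + (x1 + x2) * (d * m ^+ 2 - a - x1 - x2) ->
    exists x3 y3, collinear x1 y1 x2 y2 x3 y3.
  have [eq12 /= y12|neq12 _] := eqVneq x1 x2; last first.
    have nz : x2 - x1 != 0 by rewrite subr_eq0 eq_sym.
    apply: (ex ((y2 - y1) / (x2 - x1))); first by field.
    have -> : b = (d * y2 ^+ 2 - d * y1 ^+ 2 - (x2 ^+ 3 - x1 ^+ 3)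
       - a * (x2 ^+ 2 - x1 ^+ 2)) / (x2 - x1) by rewrite on1 on2; field.
    by field.
  have eqy : y2 = y1.
    have : (y2 - y1) * (y1 + y2) == 0.
      have /eqP : d * ((y2 - y1) * (y1 + y2)) = 0.
        transitivity (d * y2 ^+ 2 - d * y1 ^+ 2); first by ring.
        by rewrite on1 on2 eq12 subrr.
      by rewrite mulf_eq0 (negPf d_neq0).
    by rewrite mulf_eq0 (negPf y12) orbF subr_eq0 => /eqP.
  have y10 : y1 != 0.
    by move: y12; rewrite eqy -mulr2n mulrn_eq0.
  apply: (ex ((3 * x1 ^+ 2 + 2 * a * x1 + b) / (2 * d * y1))).
    by rewrite eqy eq12; ring.
  rewrite -eq12.
  have d2 : 2 * d * y1 != 0 by rewrite !mulf_neq0.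
  set m := _ / _.
  have : m * (2 * d * y1) = 3 * x1 ^+ 2 + 2 * a * x1 + b by rewrite /m divfK.
  by lra.
move=> e e2; pose x3 := d * m ^+ 2 - a - x1 - x2.
exists x3, (m * x3 + (y1 - m * x1)), m, (y1 - m * x1); split.
- by rewrite /x3; ring.
- by rewrite e2 -/x3; ring.
- have -> : c = d * y1 ^+ 2 - (x1 ^+ 3 + a * x1 ^+ 2 + b * x1) by rewrite on1; ring.
  have -> : b = 2 * d * m * (y1 - m * x1) + x1 * x2
       + (x1 + x2) * (d * m ^+ 2 - a - x1 - x2) by lra.
  by rewrite /x3; ring.
- by split; rewrite ?e; ring.
Qed.

Lemma ec_oppK P : ec_opp (ec_opp P) = P.
Proof. by case: P => //= x y; rewrite opprK. Qed.

Lemma on_opp P : on_twist d f P -> on_twist d f (ec_opp P).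
Proof. by case: P => //= x y; rewrite sqrrN. Qed.

Lemma ec_addN P : ec_add d f (ec_opp P) P = Inf.
Proof. by case: P => //= x y; rewrite eqxx addNr eqxx. Qed.

Lemma ec_addNr P : ec_add d f P (ec_opp P) = Inf.
Proof. by rewrite -{1}[P]ec_oppK ec_addN. Qed.

(** The cases of the group law, with chords and tangents treated alike. *)
Variant add_spec (P Q : ec_point) : ec_point -> Prop :=
| AddInfL of P = Inf : add_spec P Q Q
| AddInfR of Q = Inf : add_spec P Q P
| AddOpp of Q = ec_opp P : add_spec P Q Inf
| AddAff x1 y1 x2 y2 x3 y3 of P = Aff x1 y1 & Q = Aff x2 y2
   & collinear x1 y1 x2 y2 x3 (- y3) : add_spec P Q (Aff x3 y3).

Lemma addP P Q : on_twist d f P -> on_twist d f Q ->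
  add_spec P Q (ec_add d f P Q).
Proof.
case: P => [|x1 y1]; first by move=> *; apply: AddInfL.
case: Q => [|x2 y2]; first by move=> *; apply: AddInfR.
move=> on1 on2.
have [|/norP[]] := boolP ((x1 != x2) || (y1 + y2 != 0)).
  move=> /(collinear_exists on1 on2)[x3 [y3 cl]].
  by rewrite (collinear_add cl); apply: AddAff (erefl _) (erefl _) _; rewrite opprK.
rewrite !negbK => /eqP eqx /eqP eqy /=; rewrite eqx eqxx eqy eqxx /=.
by apply: AddOpp; congr Aff; rewrite -[y2](addKr y1) eqy addr0.
Qed.

Lemma on_add P Q : on_twist d f P -> on_twist d f Q ->
  on_twist d f (ec_add d f P Q).
Proof.
move=> onP onQ; case: (addP onP onQ) => // x1 y1 x2 y2 x3 y3 _ _ cl.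
by have /collinear_rot/collinear_rot/collinear_on := cl => /on_opp /=; rewrite opprK.
Qed.

Lemma ec_addC P Q : on_twist d f P -> on_twist d f Q ->
  ec_add d f P Q = ec_add d f Q P.
Proof.
move=> onP onQ; case: (addP onP onQ) => // [->|->|->|] //; try by case: (P).
- by case: (Q).
- by case: (P) => //= x y; rewrite eqxx addNr eqxx.
move=> x1 y1 x2 y2 x3 y3 -> -> /collinear_swap cl.
by rewrite (collinear_add cl) opprK.
Qed.

(** The cancellation law; it covers the cases of associativity in which two
    consecutive summands are opposite. *)
Lemma ec_addKl P Q : on_twist d f P -> on_twist d f Q ->
  ec_add d f (ec_opp P) (ec_add d f P Q) = Q.
Proof.
move=> onP onQ; case: (addP onP onQ) => // [->|->|->|] //.
- by rewrite ec_addN.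
- by case: (P).
move=> x1 y1 x2 y2 x3 y3 -> -> cl.
have := collinear_opp (collinear_swap (collinear_rot (collinear_rot cl))).
by rewrite opprK /= => /collinear_add /= ->; rewrite opprK.
Qed.

Lemma ec_addA P Q R : on_twist d f P -> on_twist d f Q -> on_twist d f R ->
  ec_add d f P (ec_add d f Q R) = ec_add d f (ec_add d f P Q) R.
Proof.
move=> onP onQ onR.
have onA := on_add onP onQ; have onB := on_add onQ onR.
case EA : _ / (addP onP onQ) => [P0|Q0|QP|x1 y1 x2 y2 x3 y3 eP eQ cA].
- by rewrite P0.
- by rewrite Q0.
- by rewrite QP -{1}[P]ec_oppK ec_addKl //; apply: on_opp.
case EB : _ / (addP onQ onR) => [Q0|R0|RQ|x1' y1' x2' y2' x3' y3' eQ' eR cB].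
- by rewrite Q0 in eQ.
- by rewrite R0 eP eQ (collinear_add cA) opprK.
- rewrite -EA (@ec_addC P Q) // RQ.
  rewrite [in RHS]ec_addC; [|exact: on_add|exact: on_opp].
  by rewrite ec_addKl // eP.
subst P Q R; case: eQ' => ex ey; rewrite -ex -ey in cB.
rewrite -EA -EB; case ES : _ / (addP onA onR) => [E0|//|RA|u v u' v' x4 y4 e1 e2 c2].
- by rewrite EA in E0.
- rewrite EA /= in RA; case: RA => -> ->.
  rewrite (collinear_add (collinear_rot cA)).
  exact: (ec_addNr (Aff x1 y1)).
rewrite EA in e1; case: e1 e2 c2 => <- <- [<- <-] c2.
by rewrite EB (collinear_add (collinear_assoc d_neq0 f_nonsing cA c2 cB)) opprK.
Qed.
End GroupLaw.

(** An encoding of points, to inherit the choice structure. *)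
Definition ec_point_code (P : ec_point) : option (rat * rat) :=
  if P is Aff x y then Some (x, y) else None.
Definition ec_point_decode (o : option (rat * rat)) : ec_point :=
  if o is Some (x, y) then Aff x y else Inf.
Lemma ec_point_codeK : cancel ec_point_code ec_point_decode.
Proof. by case. Qed.
HB.instance Definition _ := Choice.copy ec_point (can_type ec_point_codeK).

Section MordellWeilGroup.
Variables (d a b c : rat).

Definition on_twistb (P : ec_point) : bool :=
  if P is Aff x y then d * y ^+ 2 == (cubic a b c).[x] else true.

Lemma on_twistP P : reflect (on_twist d (cubic a b c) P) (on_twistb P).
Proof. by case: P => [|x y]; [exact: ReflectT | exact: eqP]. Qed.

(** The group of rational points of the twist by [d] of [y^2 = cubic a b c].
    The two proofs are parameters of the type because the group law
    requires them. *)
Definition mordell_weil of d != 0 & nonsingular (cubic a b c) :=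
  {P : ec_point | on_twistb P}.

Hypothesis (dn : d != 0) (fn : nonsingular (cubic a b c)).
Local Notation MW := (mordell_weil dn fn).
HB.instance Definition _ := Choice.on MW.
HB.instance Definition _ := SubType.on MW.

Lemma mw_on (P : MW) : on_twist d (cubic a b c) (val P).
Proof. exact/on_twistP/(valP P). Qed.

Definition mw_zero : MW := exist _ Inf isT.
Definition mw_opp (P : MW) : MW :=
  exist _ (ec_opp (val P)) (introT (on_twistP _) (on_opp (mw_on P))).
Definition mw_add (P Q : MW) : MW :=
  exist _ (ec_add d (cubic a b c) (val P) (val Q))
    (introT (on_twistP _) (on_add dn fn (mw_on P) (mw_on Q))).

Lemma mw_addA : associative mw_add.
Proof. by move=> P Q R; apply/val_inj/ec_addA => //; apply: mw_on. Qed.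
Lemma mw_addC : commutative mw_add.
Proof. by move=> P Q; apply/val_inj/ec_addC => //; apply: mw_on. Qed.
Lemma mw_add0 : left_id mw_zero mw_add.
Proof. by move=> P; apply/val_inj. Qed.
Lemma mw_addN : left_inverse mw_zero mw_opp mw_add.
Proof. by move=> P; apply/val_inj/ec_addN. Qed.

HB.instance Definition _ :=
  GRing.isZmodule.Build MW mw_addA mw_addC mw_add0 mw_addN.

Lemma val_mwD (P Q : MW) : val (P + Q) = ec_add d (cubic a b c) (val P) (val Q).
Proof. by []. Qed.
Lemma val_mwN (P : MW) : val (- P) = ec_opp (val P).
Proof. by []. Qed.
Lemma val_mw0 : val (0 : MW) = Inf.
Proof. by []. Qed.
Lemma val_mwMn (P : MW) n : val (P *+ n) = ec_muln d (cubic a b c) n (val P).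
Proof. by elim: n => // n IH; rewrite mulrS val_mwD IH. Qed.
Lemma val_mwMz (P : MW) n : val (P *~ n) = ec_mulz d (cubic a b c) n (val P).
Proof.
case: n => n; first by rewrite /= -val_mwMn.
by rewrite [RHS]/(ec_opp (ec_muln _ _ n.+1 _)) -val_mwMn.
Qed.

(** Independence of two points amounts to the absence of relations in the
    abelian group; infinite order is the case where one coefficient is 0. *)
Lemma mw_independent (P Q : MW) :
  (forall m n : int, P *~ m + Q *~ n = 0 -> m = 0 /\ n = 0) ->
  independent_points_of_infinite_order d (cubic a b c) (val P) (val Q).
Proof.
move=> ind; split; [exact: mw_on | exact: mw_on | | | ].
- move=> n n0; rewrite -val_mwMn -val_mw0 => /val_inj e.
  have [] := ind n%:Z 0; first by rewrite mulr0z addr0.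
  by move=> [e0]; rewrite e0 in n0.
- move=> n n0; rewrite -val_mwMn -val_mw0 => /val_inj e.
  have [] := ind 0 n%:Z; first by rewrite mulr0z add0r.
  by move=> _ [e0]; rewrite e0 in n0.
move=> n; rewrite !big_ord_recl big_ord0 /= !(tnth_nth Inf) /=.
rewrite -!val_mwMz -[Inf]val_mw0 -!val_mwD addr0 => /val_inj /ind[n0 n1].
by case=> -[|[|//]] lt_i2; [rewrite -n0|rewrite -n1]; congr n; apply: val_inj.
Qed.
End MordellWeilGroup.

(** * Quasi-quadratic functions on abelian groups *)

Section QuasiQuadratic.
Variables (V : zmodType) (h : V -> int) (C : int).
Hypothesis h0 : h 0 = 0.
Hypothesis hN : forall A, h (- A) = h A.
Hypothesis h_par : forall A B,
  `|h (A + B) + h (A - B) - 2 * h A - 2 * h B| <= C.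

(** The second differences of the error are at most [C], and its values at 0
    and 1 vanish. *)
Lemma quasi_quadratic_nat A (n : nat) :
  `|h (A *+ n) - n%:Z ^+ 2 * h A| <= C * n%:Z ^+ 2.
Proof.
have C0 : 0 <= C by apply: le_trans (h_par 0 0).
pose e n := h (A *+ n) - n%:Z ^+ 2 * h A.
suff /(_ n)[] : forall n, `|e n| <= C * n%:Z ^+ 2 /\ `|e n.+1 - e n| <= C * n%:Z by [].
elim=> [|{}n [IH1 IH2]].
  by rewrite /e mulr0n h0 mulr1n; split; rewrite ler_norml; lra.
split.
  move: IH1 IH2; rewrite !ler_norml => /andP[a1 a2] /andP[b1 b2].
  have -> : n.+1%:Z = n%:Z + 1 by lia.
  by apply/andP; split; lra.
have -> : e n.+2 - e n.+1 = (e n.+1 - e n) +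
   (h (A *+ n.+1 + A) + h (A *+ n.+1 - A) - 2 * h (A *+ n.+1) - 2 * h A).
  rewrite -mulrSr [in A *+ n.+1 - A]mulrSr addrK /e.
  have -> : n.+2%:Z = n%:Z + 2 by lia.
  have -> : n.+1%:Z = n%:Z + 1 by lia.
  by ring.
apply: le_trans (ler_normD _ _) _.
have := h_par (A *+ n.+1) A.
have -> : n.+1%:Z = n%:Z + 1 by lia.
by lra.
Qed.

Lemma quasi_quadratic A (n : int) :
  `|h (A *~ n) - n ^+ 2 * h A| <= C * n ^+ 2.
Proof.
case: n => n; first exact: quasi_quadratic_nat.
by rewrite NegzE mulrNz sqrrN hN; apply: quasi_quadratic_nat.
Qed.

(** A relation gives [m (P + Q) = (m - n) Q], and [m n >= 0] makes [(m - n)^2]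
    at most [|m^2 - n^2|], which is small since [h P] and [h Q] are close. *)
Lemma quasi_independent_same_sign P Q (M : int) (m n : int) :
  `|h P - h Q| <= M -> 7 * C + M < h Q -> 7 * C + M < h (P + Q) ->
  0 <= m * n -> P *~ m + Q *~ n = 0 -> m = 0 /\ n = 0.
Proof.
move=> hPQ hQ hR mn0 e.
have C0 : 0 <= C by apply: le_trans (h_par 0 0).
have M0 : 0 <= M by apply: le_trans hPQ.
have ePQ : h (P *~ m) = h (Q *~ n).
  by rewrite -[P *~ m](addrK (Q *~ n)) e add0r hN.
have eR : h ((P + Q) *~ m) = h (Q *~ (m - n)).
  by rewrite mulrzBr mulrzDl -[P *~ m](addrK (Q *~ n)) e add0r addrC.
have := quasi_quadratic (P + Q) m; have := quasi_quadratic Q (m - n).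
have := quasi_quadratic P m; have := quasi_quadratic Q n.
rewrite ePQ eR.
have : (m - n) ^+ 2 <= m ^+ 2 + n ^+ 2 by lra.
have : ((m - n) ^+ 2 <= m ^+ 2 - n ^+ 2) \/ ((m - n) ^+ 2 <= n ^+ 2 - m ^+ 2).
  by rewrite !expr2; nia.
have : 0 <= (m - n) ^+ 2 by exact: sqr_ge0.
have : 0 <= n ^+ 2 by exact: sqr_ge0.
have : 0 <= m ^+ 2 by exact: sqr_ge0.
suff : m ^+ 2 = 0 -> n ^+ 2 = 0 -> m = 0 /\ n = 0.
  move: (m ^+ 2) (n ^+ 2) ((m - n) ^+ 2) (h (Q *~ n)) (h (Q *~ (m - n))) hPQ hQ hR.
  (* a, b and c stand for m^2, n^2 and (m - n)^2. *)
  move: (h P) (h Q) (h (P + Q)) => p q r a b c x y.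
  rewrite !ler_norml => /andP[p1 p2] hq hr impl a0 b0 c0 cab cab2 /andP[u1 u2] /andP[v1 v2] /andP[w1 w2] /andP[z1 z2].
  have ap1 : a * (p - q) <= a * M by apply: ler_wpM2l.
  have ap2 : a * - M <= a * (p - q) by apply: ler_wpM2l.
  have k1 : b * (q - C) <= a * (q + C + M) by lra.
  have k2 : (a - b) * q <= C * (a + b) + M * a by lra.
  have k3 : (b - a) * q <= C * (a + b) + M * a by lra.
  have [a_eq0|a_neq0] := eqVneq a 0.
    apply: impl => //; rewrite a_eq0 mul0r in k1.
    have : 0 < q - C by lra.
    by move=> qC; move: k1; rewrite pmulr_lle0 //; lra.
  have a_gt0 : 0 < a by rewrite lt0r a_neq0.
  have ba : b <= 2 * a.
    rewrite leNgt; apply/negP => lt.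
    have : 2 * a * (q - C) < b * (q - C) by rewrite ltr_pM2r //; lra.
    have : a * (q + C + M) <= a * (2 * (q - C)) by rewrite ler_pM2l //; lra.
    by lra.
  have cq : c * q <= C * (a + b) + M * a.
    have q0 : 0 <= q by lra.
    by case: cab => /(ler_wpM2r q0); lra.
  have Cb : C * b <= C * (2 * a) by apply: ler_wpM2l.
  have Cc : C * c <= C * (3 * a) by apply: ler_wpM2l => //; lra.
  have : a * r <= a * (7 * C + M) by lra.
  by rewrite ler_pM2l //; lra.
by move=> /eqP; rewrite sqrf_eq0 => /eqP -> /eqP; rewrite sqrf_eq0 => /eqP ->.
Qed.

Lemma quasi_independent P Q (M : int) (m n : int) :
  `|h P - h Q| <= M -> 7 * C + M < h Q ->
  7 * C + M < h (P + Q) -> 7 * C + M < h (P - Q) ->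
  P *~ m + Q *~ n = 0 -> m = 0 /\ n = 0.
Proof.
move=> hPQ hQ hR hR' e.
have [mn|/ltW mn] := lerP 0 (m * n).
  exact: quasi_independent_same_sign hPQ hQ hR mn e.
have [||||-> /eqP] := @quasi_independent_same_sign P (- Q) M m (- n) _ _ hR'.
- by rewrite hN.
- by rewrite hN.
- by rewrite mulrN oppr_ge0.
- by rewrite mulrNz mulNrz opprK.
by rewrite oppr_eq0 => /eqP.
Qed.
End QuasiQuadratic.

(** * The x-coordinates of A + B and A - B on a Legendre curve *)

Lemma legendre_cubic l : legendre l = cubic (- (1 + l)) l 0.
Proof. by rewrite /legendre /cubic !polyCN !polyCD; ring. Qed.

Lemma legendre_nonsingular l : l != 0 -> l != 1 ->
  nonsingular (cubic (- (1 + l)) l 0).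
Proof.
move=> l0 l1 x; rewrite deriv_cubic horner_cubic => fx.
have /eqP : x * ((x - 1) * (x - l)) = 0 by rewrite -fx; ring.
rewrite !mulf_eq0 !subr_eq0 => /or3P[]/eqP->.
- by rewrite [X in X != _](_ : _ = l) //; ring.
- by rewrite [X in X != _](_ : _ = 1 - l) ?subr_eq0 1?eq_sym //; ring.
rewrite [X in X != _](_ : _ = l * (l - 1)); last by ring.
by rewrite mulf_neq0 ?subr_eq0.
Qed.

(** The x-coordinate as the point [(proj_x P : proj_z P)] of the projective line,
    equal to [(1 : 0)] at infinity. *)
Definition proj_x (P : ec_point) : rat := if P is Aff x _ then x else 1.
Definition proj_z (P : ec_point) : rat := if P is Aff _ _ then 1 else 0.

Section XCoordinates.
Variable l : rat.

(** If [(p1 : q1)] and [(p2 : q2)] are the x-coordinates of [A] and [B], those of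
    [A + B] and [A - B] are the roots [(X : Z)] of the binary quadratic form
    [xsum_den X^2 - xsum_mid X Z + xsum_num Z^2]. *)
Definition xsum_den (p1 q1 p2 q2 : rat) := (p1 * q2 - p2 * q1) ^+ 2.
Definition xsum_mid (p1 q1 p2 q2 : rat) :=
  2 * ((p1 * q2 + p2 * q1) * (p1 * p2 + l * q1 * q2)
       - 2 * (1 + l) * p1 * p2 * q1 * q2).
Definition xsum_num (p1 q1 p2 q2 : rat) := (p1 * p2 - l * q1 * q2) ^+ 2.

Variable d : rat.
Hypothesis (l0 : l != 0) (l1 : l != 1) (dn : d != 0).
Let f := cubic (- (1 + l)) l 0.

(** The coefficients are equal up to a factor and not only in ratio: the case
    [A = B] gives the duplication formula.  The twist [d] does not occur in
    them. *)
Lemma xsum A B : on_twist d f A -> on_twist d f B ->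
  let S := ec_add d f A B in let T := ec_add d f A (ec_opp B) in
  exists2 k : rat, k != 0 &
  [/\ k * (proj_z S * proj_z T) = xsum_den (proj_x A) (proj_z A) (proj_x B) (proj_z B),
      k * (proj_x S * proj_z T + proj_x T * proj_z S) = xsum_mid (proj_x A) (proj_z A) (proj_x B) (proj_z B)
    & k * (proj_x S * proj_x T) = xsum_num (proj_x A) (proj_z A) (proj_x B) (proj_z B)].
Proof.
case: A => [|x1 y1]; case: B => [|x2 y2] => onA onB /=;
  rewrite /xsum_den /xsum_mid /xsum_num.
- by exists 1 => //; split; ring.
- by exists 1 => //; split; ring.
- by exists 1 => //; split; ring.
move: onA onB; rewrite /= !horner_cubic => onA onB.
have [neq|] := eqVneq x1 x2; last first => /=.
  move=> neq; have nz : x2 - x1 != 0 by rewrite subr_eq0 eq_sym.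
  rewrite /ec_chord coef2_cubic /=.
  exists ((x1 - x2) ^+ 2); first by rewrite expf_neq0 // subr_eq0.
  split; first by ring.
  - transitivity (2 * (d * y1 ^+ 2) + 2 * (d * y2 ^+ 2)
       + (x2 - x1) ^+ 2 * 2 * (1 + l - x1 - x2)); first by field.
    by rewrite onA onB; ring.
  - transitivity ((((d * y1 ^+ 2) - (d * y2 ^+ 2)) ^+ 2 +
        2 * ((d * y1 ^+ 2) + (d * y2 ^+ 2)) * (1 + l - x1 - x2) * (x2 - x1) ^+ 2
        + (1 + l - x1 - x2) ^+ 2 * (x2 - x1) ^+ 4) / (x2 - x1) ^+ 2).
      by field.
    by rewrite onA onB; field.
(* The double of a point of order 2 is the point at infinity, and the common
   factor is then (x^2 - l)^2. *)
have nsum x y : d * y ^+ 2 = x ^+ 3 + - (1 + l) * x ^+ 2 + l * x + 0 ->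
   y = 0 -> (x * x - l) ^+ 2 != 0.
  move=> on y0; have /eqP : x * ((x - 1) * (x - l)) = 0.
    by transitivity (d * y ^+ 2); [rewrite on; ring | rewrite y0; ring].
  rewrite expf_eq0 /= !mulf_eq0 !subr_eq0 => /or3P[]/eqP->.
  - by rewrite mulr0 eq_sym.
  - by rewrite mulr1 eq_sym.
  by rewrite -subr_eq0 -{3}[l]mulr1 -mulrBr mulf_neq0 ?subr_eq0.
subst x2.
have y12 : (y1 - y2) * (y1 + y2) = 0.
  apply: (mulfI dn); transitivity (d * y1 ^+ 2 - d * y2 ^+ 2); first by ring.
  by rewrite onA onB subrr mulr0.
have mid : 2 * ((x1 * 1 + x1 * 1) * (x1 * x1 + l * 1 * 1)
      - 2 * (1 + l) * x1 * x1 * 1 * 1) = 4 * (d * y1 ^+ 2).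
  by rewrite onA; ring.
have [y10|y10] := eqVneq y1 0.
  have y20 : y2 = 0.
    move: y12; rewrite y10 sub0r add0r => /eqP.
    by rewrite mulf_eq0 oppr_eq0 orbb => /eqP.
  exists ((x1 * x1 - l) ^+ 2); first exact: nsum onA y10.
  by rewrite mid y10 y20 oppr0 addr0 eqxx /=; split; ring.
have k0 : 4 * (d * y1 ^+ 2) != 0 by rewrite !mulf_neq0 // expf_neq0.
have dbl : 4 * (d * y1 ^+ 2) * (d * (f^`().[x1] / (2 * d * y1)) ^+ 2
      - f`_2 - x1 - x1) = (x1 * x1 - l * 1 * 1) ^+ 2.
  transitivity (f^`().[x1] ^+ 2 + 4 * (d * y1 ^+ 2) * (- f`_2 - x1 - x1)).
    by field; rewrite y10.
  by rewrite coef2_cubic deriv_cubic onA; ring.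
have yy0 : y1 + y1 != 0 by rewrite -mulr2n mulrn_eq0.
exists (4 * (d * y1 ^+ 2)) => //; rewrite mid -dbl.
have /orP[] : (y2 == y1) || (y2 == - y1).
- rewrite -subr_eq0 -[y2 == _]subr_eq0 opprK -mulf_eq0; apply/eqP.
  by transitivity (- ((y1 - y2) * (y1 + y2))); [ring | rewrite y12 oppr0].
- move=> /eqP->; rewrite (negPf yy0) subrr eqxx /=; split; ring.
- move=> /eqP->; rewrite subrr eqxx opprK (negPf yy0) /=; split; ring.
Qed.
End XCoordinates.

(** * Heights and the parallelogram law *)

(** The x-coordinate as a pair of coprime integers, [(1, 0)] at infinity. *)
Definition xnum (P : ec_point) : int := if P is Aff x _ then numq x else 1.
Definition xden (P : ec_point) : int := if P is Aff x _ then denq x else 0.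

Lemma coprime_xnum_xden P : coprimez (xnum P) (xden P).
Proof. by case: P => //= x y; rewrite /coprimez /gcdz (eqP (coprime_num_den x)). Qed.

Lemma xnum_xden_proportional P : exists2 k : rat, k != 0 &
  (xnum P)%:~R = k * proj_x P /\ (xden P)%:~R = k * proj_z P.
Proof.
case: P => [|x y] /=; first by exists 1 => //; rewrite !mulr1.
exists (denq x)%:~R; first by rewrite intr_eq0 denq_neq0.
by rewrite mulr1 mulrC -numqE.
Qed.

(** The multiplicative height of the x-coordinate. *)
Definition ec_height (P : ec_point) : nat := maxn `|xnum P| `|xden P|.

Lemma ec_height_gt0 P : (0 < ec_height P)%N.
Proof.
rewrite /ec_height; case: P => [|x y] //=.
by rewrite leq_max !absz_gt0 denq_neq0 orbT.
Qed.

Lemma ec_height_opp P : ec_height (ec_opp P) = ec_height P.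
Proof. by case: P. Qed.

Lemma xnum_le_height P : `|xnum P| <= (ec_height P)%:Z.
Proof. by rewrite -abszE lez_nat leq_maxl. Qed.
Lemma xden_le_height P : `|xden P| <= (ec_height P)%:Z.
Proof. by rewrite -abszE lez_nat leq_maxr. Qed.

Lemma ec_height_le P (m : int) : `|xnum P| <= m -> `|xden P| <= m ->
  (ec_height P)%:Z <= m.
Proof. by rewrite -!abszE /ec_height; lia. Qed.

(** The product of two primitive binary linear forms is primitive: a common
    divisor [v] of the coefficients of [(s1 X - r1 Z) (s2 X - r2 Z)] is a unit. *)
Lemma primitive_symmetric (r1 s1 r2 s2 v a b c : int) :
  coprimez r1 s1 -> coprimez r2 s2 ->
  s1 * s2 = v * a -> r1 * s2 + r2 * s1 = v * b -> r1 * r2 = v * c ->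
  exists w, v * w = 1.
Proof.
move=> /eqP g1 /eqP g2 ea eb ec.
have [x [y]] := Bezoutz r1 s1; rewrite g1 => e1.
have [z [t]] := Bezoutz r2 s2; rewrite g2 => e2.
pose X := y * t * a + x * z * c; pose Y := y * z * (s1 * r2) + x * t * (r1 * s2).
have XY : v * X + Y = 1.
  transitivity ((x * r1 + y * s1) * (z * r2 + t * s2)); last by rewrite e1 e2.
  rewrite /X mulrDr !(mulrCA v) -ea -ec /Y; ring.
have E1 : (s1 * r2) ^+ 2 = v * (s1 * r2 * b - a * v * c).
  transitivity (s1 * r2 * (r1 * s2 + r2 * s1) - (s1 * s2) * (r1 * r2)).
    by ring.
  by rewrite ea eb ec; ring.
have E2 : (r1 * s2) ^+ 2 = v * (r1 * s2 * b - a * v * c).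
  transitivity (r1 * s2 * (r1 * s2 + r2 * s1) - (s1 * s2) * (r1 * r2)).
    by ring.
  by rewrite ea eb ec; ring.
exists (X * (v * X + 2 * Y) + (y * z) ^+ 2 * (s1 * r2 * b - a * v * c)
  + (x * t) ^+ 2 * (r1 * s2 * b - a * v * c) + 2 * (y * z) * (x * t) * a * (r1 * r2)).
transitivity ((v * X + Y) ^+ 2); last by rewrite XY.
transitivity (v * X * (v * X + 2 * Y)
   + (y * z) ^+ 2 * (v * (s1 * r2 * b - a * v * c))
   + (x * t) ^+ 2 * (v * (r1 * s2 * b - a * v * c))
   + 2 * (y * z) * (x * t) * (v * a) * (r1 * r2)); first by ring.
by rewrite -E1 -E2 -ea /Y; ring.
Qed.

(** The elementary symmetric functions of two fractions control the mixed
    products, since [(r1 s2) (r2 s1) = (s1 s2) (r1 r2)]. *)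
Lemma sym_bound (r1 s1 r2 s2 m : int) :
  `|s1 * s2| <= m -> `|r1 * s2 + r2 * s1| <= m -> `|r1 * r2| <= m ->
  `|r1 * s2| <= 2 * m.
Proof.
move=> ss rs rr; rewrite leNgt; apply/negP => lt.
have m0 : 0 <= m by apply: le_trans ss.
have lt2 : m < `|r2 * s1|.
  have : `|r1 * s2| <= `|r1 * s2 + r2 * s1| + `|r2 * s1|.
    by rewrite -{1}[r1 * s2](addrK (r2 * s1)); apply: ler_normB.
  by lra.
have : `|r1 * s2| * `|r2 * s1| <= m * m.
  rewrite -normrM [r1 * s2 * _](_ : _ = s1 * s2 * (r1 * r2)); last by ring.
  by rewrite normrM ler_pM.
have : m * m < `|r1 * s2| * `|r2 * s1|.
  apply: le_lt_trans (_ : 2 * m * m < _); first by nra.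
  by apply: ltr_pM => //; lra.
by lra.
Qed.

Lemma denq_dvd (c : rat) (z w : int) : c * z%:~R = w%:~R ->
  exists a, z = denq c * a.
Proof.
move=> e; have e1 : numq c * z = denq c * w.
  apply/eqP; rewrite -(eqr_int rat) !intrM -e numqE; apply/eqP; ring.
have : (denq c %| z)%Z.
  rewrite -(@Gauss_dvdzr _ (numq c)); first by rewrite e1 dvdz_mulr.
  by rewrite coprimez_sym /coprimez /gcdz (eqP (coprime_num_den c)).
by case/dvdzP=> a ->; exists a; rewrite mulrC.
Qed.

Lemma primitive_int (r1 s1 r2 s2 w0 w1 w2 : int) (c : rat) :
  coprimez r1 s1 -> coprimez r2 s2 ->
  c * (s1 * s2)%:~R = w0%:~R -> c * (r1 * s2 + r2 * s1)%:~R = w1%:~R ->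
  c * (r1 * r2)%:~R = w2%:~R ->
  exists2 k : int, c = k%:~R &
    [/\ k * (s1 * s2) = w0, k * (r1 * s2 + r2 * s1) = w1 & k * (r1 * r2) = w2].
Proof.
move=> co1 co2 e0 e1 e2.
have [x ex] := denq_dvd e0; have [y ey] := denq_dvd e1.
have [z ez] := denq_dvd e2.
have [w ew] := primitive_symmetric co1 co2 ex ey ez.
have d1 : denq c = 1.
  have : (denq c %| 1)%Z by rewrite -[X in (_ %| X)%Z]ew; apply: dvdz_mulr.
  by rewrite dvdz1 => /eqP; have := denq_gt0 c; lia.
have cE : c = (numq c)%:~R by rewrite numqE d1 mulr1.
exists (numq c) => //; move: e0 e1 e2; rewrite cE -!intrM.
by move=> /intr_inj <- /intr_inj <- /intr_inj <-; rewrite -cE.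
Qed.

Lemma normM_le (x y a b : int) : `|x| <= a -> `|y| <= b -> `|x * y| <= a * b.
Proof. by move=> xa yb; rewrite normrM ler_pM. Qed.

(** If [k] divides two squares, it divides the product of their roots. *)
Lemma dvd_cross (k x y a b : int) :
  x ^+ 2 = k * a -> y ^+ 2 = k * b -> exists w, x * y = k * w.
Proof.
move=> ex ey; have : (k ^+ 2 %| (x * y) ^+ 2)%Z.
  by apply/dvdzP; exists (a * b); rewrite exprMn ex ey; ring.
rewrite dvdz_pexp2r // => /dvdzP[w ->]; by exists w; rewrite mulrC.
Qed.

Lemma height_mul_le S T (M : int) :
  `|xden S * xden T| <= M -> `|xnum S * xden T + xnum T * xden S| <= M ->
  `|xnum S * xnum T| <= M ->
  (ec_height S)%:Z * (ec_height T)%:Z <= 2 * M.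
Proof.
move=> b0 b1 b2; have M0 : 0 <= M by apply: le_trans b0.
have M2 : M <= 2 * M by lra.
have x1 := sym_bound b0 b1 b2.
have x2 : `|xnum T * xden S| <= 2 * M.
  by apply: (@sym_bound _ (xden T) (xnum S)); rewrite 1?addrC // mulrC.
have hmax P : (ec_height P)%:Z = `|xnum P| \/ (ec_height P)%:Z = `|xden P|.
  by rewrite -!abszE /ec_height; lia.
case: (hmax S) => ->; case: (hmax T) => ->; rewrite -normrM //.
- exact: le_trans b2 M2.
- by rewrite mulrC.
- exact: le_trans b0 M2.
Qed.

Section Heights.
Variable l : rat.
Hypothesis (l0 : l != 0) (l1 : l != 1).
Let f := cubic (- (1 + l)) l 0.
Let L := numq l.
Let E := denq l.

(** The formulas [xsum] in coprime integer coordinates, with denominators of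
    [l = L / E] cleared. *)
Lemma xsum_int d A B : d != 0 -> on_twist d f A -> on_twist d f B ->
  let S := ec_add d f A B in let T := ec_add d f A (ec_opp B) in
  let p1 := xnum A in let q1 := xden A in let p2 := xnum B in let q2 := xden B in
  exists2 c : rat, c != 0 &
  [/\ c * (xden S * xden T)%:~R = (E ^+ 2 * (p1 * q2 - p2 * q1) ^+ 2)%:~R,
      c * (xnum S * xden T + xnum T * xden S)%:~R =
      (2 * E * ((p1 * q2 + p2 * q1) * (E * p1 * p2 + L * q1 * q2)
       - 2 * (E + L) * p1 * p2 * q1 * q2))%:~R
    & c * (xnum S * xnum T)%:~R = ((E * p1 * p2 - L * q1 * q2) ^+ 2)%:~R].
Proof.
move=> dn onA onB S T p1 q1 p2 q2.
have [k k0 [e0 e1 e2]] := xsum l0 l1 dn onA onB.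
rewrite -/f -/S -/T in e0 e1 e2.
have [kA kA0 [pA qA]] := xnum_xden_proportional A; have [kB kB0 [pB qB]] := xnum_xden_proportional B.
have [kS kS0 [pS qS]] := xnum_xden_proportional S; have [kT kT0 [pT qT]] := xnum_xden_proportional T.
have E0 : E%:~R != 0 :> rat by rewrite intr_eq0 denq_neq0.
have LE : L%:~R = l * E%:~R by rewrite -numqE.
exists (k * (kA * kB * E%:~R) ^+ 2 / (kS * kT)).
  by rewrite !mulf_neq0 ?invr_eq0 ?expf_neq0 ?mulf_neq0.
rewrite !(rmorphM, rmorphD, rmorphB, rmorphXn, rmorphN) /= LE pA qA pB qB pS qS pT qT.
split.
- transitivity ((kA * kB * E%:~R) ^+ 2 * (k * (proj_z S * proj_z T))).
    by field; rewrite kS0 kT0.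
  by rewrite e0 /xsum_den; ring.
- transitivity ((kA * kB * E%:~R) ^+ 2 * (k * (proj_x S * proj_z T + proj_x T * proj_z S))).
    by field; rewrite kS0 kT0.
  by rewrite e1 /xsum_mid; ring.
transitivity ((kA * kB * E%:~R) ^+ 2 * (k * (proj_x S * proj_x T))).
  by field; rewrite kS0 kT0.
by rewrite e2 /xsum_num; ring.
Qed.

Let F : int := E + `|L|.

(** The factor relating the primitive form with roots the x-coordinates of
    [A + B] and [A - B] to the integral one of [xsum_int] is an integer, so the
    former has the smaller coefficients. *)
Lemma height_add_sub d A B : d != 0 -> on_twist d f A -> on_twist d f B ->
  (ec_height (ec_add d f A B))%:Z * (ec_height (ec_add d f A (ec_opp B)))%:Z
    <= 32 * F ^+ 2 * ((ec_height A)%:Z * (ec_height B)%:Z) ^+ 2.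
Proof.
move=> dn onA onB; have [c c0 [e0 e1 e2]] := xsum_int dn onA onB.
move: e0 e1 e2; set S := ec_add d f A B; set T := ec_add d f A (ec_opp B).
move=> e0 e1 e2; have [k kE []] := primitive_int (coprime_xnum_xden S) (coprime_xnum_xden T) e0 e1 e2.
have k1 : 1 <= `|k| by rewrite -gtz0_ge1 normr_gt0 -(intr_eq0 rat) -kE.
have kle x w : k * x = w -> `|x| <= `|w|.
  by move=> <-; rewrite normrM ler_peMl.
set a := (ec_height A)%:Z; set b := (ec_height B)%:Z.
have E0 : 0 < E by exact: denq_gt0.
have nE : `|E| <= E by rewrite gtr0_norm.
have nL : `|L| <= `|L| by [].
have [pa qa] := (xnum_le_height A, xden_le_height A); rewrite -/a in pa qa.
have [pb qb] := (xnum_le_height B, xden_le_height B); rewrite -/b in pb qb.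
have ab0 : 0 <= a * b by rewrite mulr_ge0.
have L0 : 0 <= `|L| by [].
have EF : E <= F by rewrite /F lerDl.
move=> /kle b0 /kle b1 /kle b2.
pose M := 16 * F ^+ 2 * (a * b) ^+ 2.
have F2 : E * F <= F ^+ 2 by rewrite expr2 ler_wpM2r //; lra.
have F3 : E * E <= F ^+ 2 by rewrite expr2 ler_pM // ltW.
have Fab : 0 <= F ^+ 2 * (a * b) ^+ 2 by rewrite mulr_ge0 ?sqr_ge0.
have ab2 : 0 <= (a * b) ^+ 2 by apply: sqr_ge0.
have cross x y z t : `|x| <= a -> `|y| <= b -> `|z| <= a -> `|t| <= b ->
    `|E * x * y| + `|L * z * t| <= F * (a * b).
  move=> xa yb za tb; have := normM_le (normM_le nE xa) yb.
  by have := normM_le (normM_le nL za) tb; rewrite /F; lra.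
have b0' : `|xden S * xden T| <= M.
  apply: le_trans b0 _; rewrite normrM !normrX (ger0_norm (ltW E0)).
  have h : `|xnum A * xden B - xnum B * xden A| <= 2 * (a * b).
    apply: le_trans (ler_normB _ _) _.
    by have := normM_le pa qb; have := normM_le pb qa; lra.
  have := normM_le (a := 2 * (a * b)) h h; rewrite normrM -expr2.
  move=> /(ler_wpM2l (sqr_ge0 E)) /le_trans; apply.
  rewrite /M; have := ler_wpM2r ab2 F3; lra.
have b2' : `|xnum S * xnum T| <= M.
  apply: le_trans b2 _; rewrite normrX.
  have h : `|E * xnum A * xnum B - L * xden A * xden B| <= F * (a * b).
    by apply: le_trans (ler_normB _ _) _; apply: cross.
  have := normM_le h h; rewrite normrM -expr2 => /le_trans; apply.
  by rewrite /M; lra.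
have b1' : `|xnum S * xden T + xnum T * xden S| <= M.
  apply: le_trans b1 _; rewrite !normrM (ger0_norm (ltW E0)) ger0_norm //.
  have h : `|xnum A * xden B + xnum B * xden A| <= 2 * (a * b).
    apply: le_trans (ler_normD _ _) _.
    by have := normM_le pa qb; have := normM_le pb qa; lra.
  have h' : `|E * xnum A * xnum B + L * xden A * xden B| <= F * (a * b).
    by apply: le_trans (ler_normD _ _) _; apply: cross.
  have FEL : `|E + L| <= F by rewrite /F -{2}(ger0_norm (ltW E0)) ler_normD.
  have h2 := normM_le (normM_le (normM_le (normM_le FEL pa) pb) qa) qb.
  have h1 := normM_le h h'.
  have h3 : `|(xnum A * xden B + xnum B * xden A) * (E * xnum A * xnum B + L * xden A * xden B) -
     2 * (E + L) * xnum A * xnum B * xden A * xden B| <= 4 * F * (a * b) ^+ 2.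
    apply: le_trans (ler_normB _ _) _.
    have -> : 2 * (E + L) * xnum A * xnum B * xden A * xden B =
      2 * ((E + L) * xnum A * xnum B * xden A * xden B) by ring.
    rewrite [`|2 * (_ * xden B)|]normrM ger0_norm //.
    by lra.
  rewrite /M; have := ler_wpM2l (ltW E0) h3; have := ler_wpM2r ab2 F2; lra.
have -> : 32 * F ^+ 2 * (a * b) ^+ 2 = 2 * M by rewrite /M; ring.
exact: height_mul_le.
Qed.
(** Here [(p, q)] and [(r, s)] are the x-coordinates of [A] and [2A].  The three
    values [x(2A) - e], for [e] one of the roots 0, 1 and [l], are squares of
    quadratic polynomials in [x(A)] over a common denominator; these span the
    quadratic forms in [p], [q].  This bounds both the cancellation [k] in the
    duplication formula and the size of [p], [q]. *)
Lemma duplication_gcd (k r s p q : int) : coprimez p q ->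
  k * s = 4 * E * (p * q) * (E * p ^+ 2 - (E + L) * (p * q) + L * q ^+ 2) ->
  k * r = (E * p ^+ 2 - L * q ^+ 2) ^+ 2 ->
  let K := (4 * E * L * (L - E)) ^+ 2 in
  [/\ `|k| <= K, p ^+ 4 <= 12 * K * F ^+ 2 * Num.max `|r| `|s|
    & q ^+ 4 <= 12 * K * F ^+ 2 * Num.max `|r| `|s|].
Proof.
move=> co es er K.
have E0 : 0 < E by exact: denq_gt0.
have L0 : L != 0 by rewrite numq_eq0.
have LE0 : L - E != 0.
  rewrite subr_eq0; apply: contra l1 => /eqP LE.
  by rewrite -[l]divq_num_den -/L -/E LE divff // intr_eq0 denq_neq0.
(* The square roots of k r, k (r - s) and k (E^2 r - E L s). *)
pose s0 := E * p ^+ 2 - L * q ^+ 2.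
pose s1 := E * p ^+ 2 - 2 * E * (p * q) + L * q ^+ 2.
pose s2 := E * (E * p ^+ 2 - 2 * L * (p * q) + L * q ^+ 2).
have k0 : s0 ^+ 2 = k * r by rewrite er.
have k1 : s1 ^+ 2 = k * (r - s) by rewrite mulrBr er es /s1; ring.
have k2 : s2 ^+ 2 = k * (E ^+ 2 * r - E * L * s).
  by rewrite mulrBr !(mulrCA k) er es /s2; ring.
have [x01 e01] := dvd_cross k0 k1.
have [x02 e02] := dvd_cross k0 k2.
have [x12 e12] := dvd_cross k1 k2.
have P2 : 2 * E * (L - E) * p ^+ 2 = (L - E) * s0 + L * s1 - s2.
  by rewrite /s0 /s1 /s2; ring.
have Q2 : 2 * L * (L - E) * q ^+ 2 = - (L - E) * s0 + L * s1 - s2.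
  by rewrite /s0 /s1 /s2; ring.
have sq (u v w : int) : (u * s0 + v * s1 - w * s2) ^+ 2 =
   k * (u ^+ 2 * r + v ^+ 2 * (r - s) + w ^+ 2 * (E ^+ 2 * r - E * L * s)
     + 2 * u * v * x01 - 2 * u * w * x02 - 2 * v * w * x12).
  transitivity (u ^+ 2 * (k * r) + v ^+ 2 * (k * (r - s))
      + w ^+ 2 * (k * (E ^+ 2 * r - E * L * s))
     + 2 * u * v * (k * x01) - 2 * u * w * (k * x02) - 2 * v * w * (k * x12)).
    by rewrite -k0 -k1 -k2 -e01 -e02 -e12; ring.
  by ring.
have K_neq0 : K != 0 by rewrite expf_neq0 // !mulf_neq0 //; lia.
(* k divides K p^4 and K q^4, where p and q are coprime. *)
have kK : `|k| <= K.
  have kp : (k %| K * p ^+ 4)%Z.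
    apply/dvdzP; exists (4 * L ^+ 2 * ((L - E) ^+ 2 * r + L ^+ 2 * (r - s)
      + (E ^+ 2 * r - E * L * s)
     + 2 * (L - E) * L * x01 - 2 * (L - E) * x02 - 2 * L * x12)).
    transitivity (4 * L ^+ 2 * (2 * E * (L - E) * p ^+ 2) ^+ 2).
      by rewrite /K; ring.
    rewrite P2 -[s2 in LHS]mul1r sq; ring.
  have kq : (k %| K * q ^+ 4)%Z.
    apply/dvdzP; exists (4 * E ^+ 2 * ((L - E) ^+ 2 * r + L ^+ 2 * (r - s)
      + (E ^+ 2 * r - E * L * s)
     - 2 * (L - E) * L * x01 + 2 * (L - E) * x02 - 2 * L * x12)).
    transitivity (4 * E ^+ 2 * (2 * L * (L - E) * q ^+ 2) ^+ 2).
      by rewrite /K; ring.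
    rewrite Q2 -[s2 in LHS]mul1r sq; ring.
  have : (k %| gcdz (K * p ^+ 4) (K * q ^+ 4))%Z by rewrite dvdz_gcd kp kq.
  have copq : coprimez (p ^+ 4) (q ^+ 4) by apply: coprimezXl; apply: coprimezXr.
  rewrite -mulz_gcdr (eqP copq) mulr1 dvdzE => /dvdn_leq.
  rewrite absz_id absz_gt0 => /(_ K_neq0); rewrite -lez_nat !abszE.
  by rewrite (ger0_norm (sqr_ge0 _)).
set m := Num.max _ _.
have rm : `|r| <= m by rewrite le_max lexx.
have sm : `|s| <= m by rewrite le_max lexx orbT.
have K0 : 0 <= K by exact: sqr_ge0.
have m0 : 0 <= m by apply: le_trans rm.
have nL : `|L| <= `|L| by [].
have EF : E <= F by rewrite /F lerDl.
have LF : `|L| <= F by rewrite /F lerDr ltW.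
have km : `|k| * m <= K * m by apply: ler_wpM2r.
have Km : 0 <= K * m by apply: mulr_ge0.
have F0 : 0 <= F by lra.
have kx (x : int) c : 0 <= c -> `|x| <= c * m -> k * x <= c * (K * m).
  move=> c0 xc; apply: le_trans (ler_norm _) _; rewrite normrM.
  apply: le_trans (ler_wpM2l (normr_ge0 k) xc) _.
  by rewrite mulrCA ler_wpM2l.
have b0 : s0 ^+ 2 <= 1 * (K * m) by rewrite k0; apply: kx => //; rewrite mul1r.
have b1 : s1 ^+ 2 <= 2 * (K * m).
  rewrite k1; apply: kx => //; apply: le_trans (ler_normB _ _) _; lra.
have b2 : s2 ^+ 2 <= F ^+ 2 * (K * m).
  rewrite k2; apply: kx; first exact: sqr_ge0.
  apply: le_trans (ler_normB _ _) _; rewrite !normrM !(gtr0_norm E0).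
  have -> : F ^+ 2 * m = F * F * m by ring.
  have : E * F * m <= F * F * m by rewrite !ler_wpM2r.
  have : E ^+ 2 * `|r| <= E ^+ 2 * m by rewrite ler_wpM2l ?sqr_ge0.
  have : E * `|L| * `|s| <= E * `|L| * m by rewrite ler_wpM2l ?mulr_ge0 // ltW.
  by rewrite /F; lra.
have sqF x : `|x| <= F -> x ^+ 2 <= F ^+ 2.
  by move=> xF; rewrite -(ger0_norm (sqr_ge0 x)) normrX lerXn2r ?nnegrE.
have LEF : (L - E) ^+ 2 <= F ^+ 2.
  apply: sqF; apply: le_trans (ler_normB _ _) _.
  by rewrite (gtr0_norm E0) addrC.
have LF2 : L ^+ 2 <= F ^+ 2 by apply: sqF.
have F2K : 0 <= F ^+ 2 * (K * m) by rewrite mulr_ge0 ?sqr_ge0.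
have three u : u ^+ 2 = (L - E) ^+ 2 ->
    (u * s0 + L * s1 - s2) ^+ 2 <= 12 * K * F ^+ 2 * m.
  move=> uE.
  have : (u * s0 + L * s1 - s2) ^+ 2
      <= 3 * (u ^+ 2 * s0 ^+ 2 + L ^+ 2 * s1 ^+ 2 + s2 ^+ 2).
    rewrite -subr_ge0 (_ : _ - _ = (u * s0 - L * s1) ^+ 2 + (u * s0 + s2) ^+ 2
       + (L * s1 + s2) ^+ 2); last by ring.
    by rewrite !addr_ge0 ?sqr_ge0.
  move/le_trans; apply; rewrite uE.
  have : (L - E) ^+ 2 * s0 ^+ 2 <= F ^+ 2 * (1 * (K * m)).
    by apply: ler_pM => //; apply: sqr_ge0.
  have : L ^+ 2 * s1 ^+ 2 <= F ^+ 2 * (2 * (K * m)).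
    by apply: ler_pM => //; apply: sqr_ge0.
  by lra.
have big (c x : int) : c != 0 -> x ^+ 4 <= (c * x ^+ 2) ^+ 2.
  move=> c0; rewrite exprMn -exprM; apply: ler_peMl.
    by rewrite (exprM x 2 2) sqr_ge0.
  by rewrite -gtz0_ge1 lt0r sqr_ge0 expf_neq0.
split=> //.
  apply: le_trans (big (2 * E * (L - E)) _ _) _; last by rewrite P2 three.
  by rewrite !mulf_neq0 //; lia.
apply: le_trans (big (2 * L * (L - E)) _ _) _; last by rewrite Q2 three ?sqrrN.
by rewrite !mulf_neq0.
Qed.
End Heights.

(** * Logarithmic heights *)

Lemma trunc_log2_lt (n : nat) : (n < 2 ^ (trunc_log 2 n).+1)%N.
Proof. exact: trunc_log_ltn. Qed.

Lemma trunc_log2_prod_le (a b c e k : nat) : (0 < a)%N -> (0 < b)%N ->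
  (a * b <= k * (c * e) ^ 2)%N ->
  (trunc_log 2 a + trunc_log 2 b <=
     2 * trunc_log 2 c + 2 * trunc_log 2 e + (trunc_log 2 k + 5))%N.
Proof.
move=> a0 b0 le; rewrite -ltnS -(@ltn_exp2l 2) // expnD.
apply: leq_ltn_trans (leq_mul (trunc_logP _ a0) (trunc_logP _ b0)) _ => //.
apply: leq_ltn_trans le _.
have c1 := trunc_log2_lt c; have e1 := trunc_log2_lt e.
have k1 := trunc_log2_lt k.
apply: leq_ltn_trans (_ : _ <= 2 ^ (trunc_log 2 k).+1 *
  (2 ^ (trunc_log 2 c).+1 * 2 ^ (trunc_log 2 e).+1) ^ 2)%N _.
  by apply: leq_mul; [exact: ltnW | rewrite leq_exp2r // leq_mul // ltnW].
rewrite -!expnD -expnM -expnD ltn_exp2l //; lia.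
Qed.

Lemma trunc_log2_exp4_le (a b k : nat) : (0 < a)%N -> (a ^ 4 <= k * b)%N ->
  (4 * trunc_log 2 a <= trunc_log 2 b + (trunc_log 2 k + 1))%N.
Proof.
move=> a0 le; rewrite -ltnS -(@ltn_exp2l 2) // mulnC expnM.
apply: leq_ltn_trans (_ : _ <= a ^ 4)%N _.
  by rewrite leq_exp2r // trunc_logP.
apply: leq_ltn_trans le _.
apply: leq_trans (ltn_mul (trunc_log2_lt k) (trunc_log2_lt b)) _.
rewrite -expnD leq_exp2l //; lia.
Qed.

(** The logarithmic height, rounded down to an integer; every estimate below is
    up to a bounded error, which absorbs the rounding. *)
Definition log_height (P : ec_point) : int := (trunc_log 2 (ec_height P))%:Z.

Section LogHeights.
Variable l : rat.
Hypothesis (l0 : l != 0) (l1 : l != 1).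
Local Notation f := (cubic (- (1 + l)) l 0).

Lemma log_height_add_sub : exists C : int, forall d A B, d != 0 ->
  on_twist d f A -> on_twist d f B ->
  log_height (ec_add d f A B) + log_height (ec_add d f A (ec_opp B))
    <= 2 * log_height A + 2 * log_height B + C.
Proof.
set F : int := denq l + `|numq l|; pose k := absz (32 * F ^+ 2)%R.
exists ((trunc_log 2 k + 5)%N : int) => d A B dn onA onB.
have := height_add_sub l0 l1 dn onA onB; rewrite -/F.
have -> : 32 * F ^+ 2 = k%:Z by rewrite abszE ger0_norm // mulr_ge0 ?sqr_ge0.
rewrite /log_height; move: (ec_height_gt0 (ec_add d f A B)).
move: (ec_height_gt0 (ec_add d f A (ec_opp B))).
move: (ec_height _) (ec_height (ec_add d f A B)) (ec_height A) (ec_height B).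
move=> b a a' b' b0 a0 le.
have /(trunc_log2_prod_le a0 b0) : (a * b <= k * (a' * b') ^ 2)%N.
  by rewrite -lez_nat -mulnn !PoszM -expr2.
by lia.
Qed.

Lemma log_height_double : exists C : int, forall d A, d != 0 ->
  on_twist d f A -> 4 * log_height A <= log_height (ec_add d f A A) + C.
Proof.
set F : int := denq l + `|numq l|.
pose K : int := 12 * (4 * denq l * numq l * (numq l - denq l)) ^+ 2 * F ^+ 2.
exists ((trunc_log 2 (absz K) + 1)%N : int) => d A dn onA; rewrite /log_height.
have [c c0 [e0 e1 e2]] := xsum_int l0 l1 dn onA onA.
have [k _ [_]] := primitive_int (coprime_xnum_xden _) (coprime_xnum_xden _) e0 e1 e2.
rewrite ec_addNr /= mul1r mulr0 add0r mulr1 => eD eN.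
set S := ec_add d f A A in eD eN *.
have [||_ hp hq] := @duplication_gcd l l0 l1 k (xnum S) (xden S) _ _ (coprime_xnum_xden A).
- by rewrite eD; ring.
- by rewrite eN; ring.
have max_height P : Num.max `|xnum P| `|xden P| = (ec_height P)%:Z.
  by rewrite -!abszE maxEle lez_nat /ec_height; case: leqP => ?; lia.
rewrite max_height -/F -/K in hp hq.
have K0 : 0 <= K by apply/mulr_ge0/sqr_ge0/mulr_ge0/sqr_ge0.
have /(trunc_log2_exp4_le (ec_height_gt0 A)) :
    (ec_height A ^ 4 <= absz K * ec_height S)%N.
  rewrite -lez_nat PoszM abszE (ger0_norm K0).
  have -> : (ec_height A ^ 4)%N%:Z = (ec_height A)%:Z ^+ 4.
    by rewrite !expnS expn0 !PoszM; ring.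
  have e4 (x : int) : `|x| ^+ 4 = x ^+ 4.
    by rewrite -normrX ger0_norm // (exprM x 2 2) sqr_ge0.
  by rewrite -(max_height A) maxEle; case: ifP => _; rewrite e4.
by lia.
Qed.

(** The lower bound for [h(A + B) + h(A - B)] is the upper bound applied to
    [A + B] and [A - B], whose sum and difference are [2A] and [2B]. *)
Lemma log_height_quasi_quadratic : exists C : int,
  forall d (dn : d != 0) (A B : mordell_weil dn (legendre_nonsingular l0 l1)),
  `|log_height (val (A + B)) + log_height (val (A - B))
     - 2 * log_height (val A) - 2 * log_height (val B)| <= C.
Proof.
have [C1 add_sub] := log_height_add_sub.
have [C2 double] := log_height_double.
exists (`|C1| + `|C2| * 2) => d dn A B.
pose h (P : mordell_weil dn (legendre_nonsingular l0 l1)) := log_height (val P).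
rewrite -!/(h _).
have add_sub' (P Q : mordell_weil dn (legendre_nonsingular l0 l1)) :
    h (P + Q) + h (P - Q) <= 2 * h P + 2 * h Q + C1.
  exact: add_sub dn (mw_on P) (mw_on Q).
have double' (P : mordell_weil dn (legendre_nonsingular l0 l1)) :
    4 * h P <= h (P + P) + C2 by exact: double dn (mw_on P).
have := add_sub' A B; have := double' A; have := double' B.
have := add_sub' (A + B) (A - B).
have -> : A + B + (A - B) = A + A by rewrite addrACA subrr addr0.
have -> : A + B - (A - B) = B + B by rewrite opprB (addrC A B) addrACA subrr addr0.
have := ler_norm C1; have := ler_norm C2.
have := normr_ge0 C1; have := normr_ge0 C2.
by rewrite ler_norml; lra.
Qed.
End LogHeights.

(** * Finiteness, and heights under homographies *)

(** Containment in a list. *)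
Definition finite (T : eqType) (S : T -> Prop) : Prop :=
  exists s : seq T, forall x, S x -> x \in s.

Lemma finite_sub (T : eqType) (S S' : T -> Prop) :
  (forall x, S x -> S' x) -> finite S' -> finite S.
Proof. by move=> sub [s fs]; exists s => x /sub/fs. Qed.

Lemma finite_or (T : eqType) (S S' : T -> Prop) :
  finite S -> finite S' -> finite (fun x => S x \/ S' x).
Proof.
move=> [s fs] [s' fs']; exists (s ++ s') => x.
by rewrite mem_cat => -[/fs->|/fs'->] //; rewrite orbT.
Qed.

Lemma finite_bind (T U : eqType) (S : T -> Prop) (R : T -> U -> Prop) :
  finite S -> (forall x, finite (R x)) -> finite (fun y => exists2 x, S x & R x y).
Proof.
move=> [s fs] fR.
suff [s' fs'] : exists s' : seq U, forall x y, x \in s -> R x y -> y \in s'.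
  by exists s' => y [x /fs xs /(fs' _ _ xs)].
elim: s {fs} => [|x s [s' IH]]; first by exists [::].
have [s1 f1] := fR x; exists (s1 ++ s') => z y.
rewrite inE mem_cat => /orP[/eqP->/f1->//|zs /(IH _ _ zs)->].
exact: orbT.
Qed.

(** The complex roots form a list; the rational ones are found among them. *)
Lemma finite_roots (p : {poly rat}) : p != 0 -> finite (fun x => p.[x] = 0).
Proof.
move=> p0; have [r er] := closed_field_poly_normal (map_poly (ratr : rat -> algC) p).
exists [seq getCrat z | z <- r] => x px.
have x_in_r : ratr x \in r.
  have : root (map_poly ratr p) (ratr x : algC) by rewrite fmorph_root; apply/eqP.
  rewrite er rootZ ?root_prod_XsubC //.
  by rewrite lead_coef_eq0 map_poly_eq0.
by apply/mapP; exists (ratr x); rewrite // ratCK.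
Qed.

(** Northcott's property of the rational numbers. *)
Lemma finite_height_le (K : int) : finite (fun x => log_height (Aff x 0) <= K).
Proof.
pose n := (2 ^ `|K|.+1)%N.
exists [seq p.1%:~R / (p.2%:~R : rat) |
  p <- allpairs pair ([seq Posz i | i <- iota 0 n.+1] ++ [seq - Posz i | i <- iota 0 n.+1])
         [seq Posz i | i <- iota 0 n.+1]] => x hx.
have hn : (ec_height (Aff x 0%R) < n)%N.
  apply: leq_trans (trunc_log2_lt _) _; rewrite leq_exp2l // ltnS.
  by move: hx; rewrite /log_height; lia.
have nn : (`|numq x| < n.+1)%N.
  rewrite ltnS; apply: leq_trans (ltnW hn); exact: leq_maxl.
have dn : (`|denq x| < n.+1)%N.
  rewrite ltnS; apply: leq_trans (ltnW hn); exact: leq_maxr.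
apply/mapP; exists (numq x, denq x); last by rewrite divq_num_den.
apply: allpairs_f; last first.
  apply/mapP; exists `|denq x|%N; first by rewrite mem_iota.
  by rewrite abszE gtr0_norm.
rewrite mem_cat; apply/orP.
have [x0|x0] := lerP 0 (numq x); [left|right]; apply/mapP.
  by exists `|numq x|%N; rewrite ?mem_iota // abszE ger0_norm.
by exists `|numq x|%N; rewrite ?mem_iota // abszE ltr0_norm // opprK.
Qed.

Lemma rat4_common_denominator (p q r s : rat) : exists2 D : rat, D != 0 &
  exists P Q R S : int,
  [/\ D * p = P%:~R, D * q = Q%:~R, D * r = R%:~R & D * s = S%:~R].
Proof.
exists (denq p * denq q * denq r * denq s)%:~R.
  by rewrite intr_eq0 !mulf_neq0.
exists (numq p * denq q * denq r * denq s), (denq p * numq q * denq r * denq s),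
  (denq p * denq q * numq r * denq s), (denq p * denq q * denq r * numq s).
by rewrite !rmorphM /= !numqE; split; ring.
Qed.

Lemma norm_comb_le (u v x y h k : int) : `|u| + `|v| <= k ->
  `|x| <= h -> `|y| <= h -> `|u * x + v * y| <= k * h.
Proof.
move=> uv xh yh; apply: le_trans (ler_normD _ _) _.
have ux := normM_le (lexx `|u|) xh; have vy := normM_le (lexx `|v|) yh.
apply: le_trans (lerD ux vy) _; rewrite -mulrDl.
by apply: ler_wpM2r uv; apply: le_trans xh.
Qed.

Lemma dist_le_of_le_add (u v C C' : int) :
  u <= v + C -> v <= u + C' -> `|u - v| <= `|C| + `|C'|.
Proof. by lia. Qed.

(** The equation states that [x' = (p x + q) / (r x + s)]; the denominator cannot
    vanish because the determinant is nonzero. *)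
Lemma log_height_moebius_le (p q r s : rat) : p * s - q * r != 0 ->
  exists C : int, forall x x', x' * (r * x + s) = p * x + q ->
  log_height (Aff x' 0) <= log_height (Aff x 0) + C.
Proof.
move=> det0; have [D D0 [P [Q [R [S [eP eQ eR eS]]]]]] := rat4_common_denominator p q r s.
pose K := (`|P| + `|Q| + `|R| + `|S|)%N.
exists ((trunc_log 2 K).+2 : int) => x x' e.
have dx0 := denq_neq0 x; have dx'0 := denq_neq0 x'.
have rs0 : r * x + s != 0.
  apply: contra det0 => /eqP rs; rewrite rs mulr0 in e.
  have -> : p * s - q * r = p * (r * x + s) - r * (p * x + q) by ring.
  by rewrite rs -e !mulr0 subrr.
pose c := D * (denq x)%:~R * (r * x + s) / (denq x')%:~R.
have c0 : c != 0 by rewrite !mulf_neq0 ?invr_eq0 ?intr_eq0.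
have e1 : c * (denq x')%:~R = (R * numq x + S * denq x)%:~R.
  by rewrite rmorphD !rmorphM /= -eR -eS numqE /c; field; rewrite intr_eq0.
have e2 : c * (numq x')%:~R = (P * numq x + Q * denq x)%:~R.
  rewrite rmorphD !rmorphM /= -eP -eQ !numqE.
  transitivity (D * (denq x)%:~R * (x' * (r * x + s))).
    by rewrite /c; field; rewrite intr_eq0.
  by rewrite e; ring.
have [a ea] := denq_dvd e1; have [b eb] := denq_dvd e2.
have d1 : denq c = 1.
  have : (denq c %| gcdz (numq x') (denq x'))%Z.
    by rewrite dvdz_gcd ea eb !dvdz_mulr.
  have /eqP -> := coprime_xnum_xden (Aff x' 0).
  by rewrite dvdz1 => /eqP; have := denq_gt0 c; lia.
have cE : c = (numq c)%:~R by rewrite numqE d1 mulr1.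
have nc : 1 <= `|numq c| by rewrite -gtz0_ge1 normr_gt0 numq_eq0.
have le (u v : int) : c * u%:~R = v%:~R -> `|u| <= `|v|.
  by rewrite cE -intrM => /intr_inj <-; rewrite normrM ler_peMl.
have {}e1 := le _ _ e1; have {}e2 := le _ _ e2.
set h := ec_height (Aff x 0).
have [nx dx] := (xnum_le_height (Aff x 0), xden_le_height (Aff x 0)).
rewrite -/h /= in nx dx.
have bound U V : (`|U| + `|V| <= K)%N -> `|U * numq x + V * denq x| <= K%:Z * h%:Z.
  by rewrite -lez_nat PoszD !abszE => UV; apply: norm_comb_le.
have : (ec_height (Aff x' 0))%:Z <= K%:Z * h%:Z.
  apply: ec_height_le; [apply: le_trans e2 _ | apply: le_trans e1 _];
    by apply: bound; rewrite /K; lia.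
rewrite -PoszM lez_nat => hh.
rewrite /log_height -PoszD lez_nat -ltnS -(@ltn_exp2l 2) //.
apply: leq_ltn_trans (trunc_logP _ (ec_height_gt0 _)) _ => //.
apply: leq_ltn_trans hh _.
apply: leq_trans (ltn_mul (trunc_log2_lt _) (trunc_log2_lt _)) _.
rewrite -expnD leq_exp2l // -/h; lia.
Qed.

(** The inverse homography satisfies the same equation, solved for [x]. *)
Lemma log_height_moebius (p q r s : rat) : p * s - q * r != 0 ->
  exists C : int, forall x x', x' * (r * x + s) = p * x + q ->
  `|log_height (Aff x' 0) - log_height (Aff x 0)| <= C.
Proof.
move=> det0; have [C hC] := log_height_moebius_le det0.
have det0' : (- s) * (- p) - q * r != 0 by rewrite mulrNN mulrC.
have [C' hC'] := log_height_moebius_le det0'.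
exists (`|C| + `|C'|) => x x' e.
have e' : x * (r * x' + - p) = - s * x' + q.
  have -> : q = x' * (r * x + s) - p * x by rewrite e; ring.
  by ring.
exact: dist_le_of_le_add (hC _ _ e) (hC' _ _ e').
Qed.

(** * Independence for all but finitely many parameters *)

(** The constant depends on the curve [l] only, not on the twist [d]. *)
Lemma twist_independent l : l != 0 -> l != 1 -> exists C : int,
  forall (d : rat) (P Q : ec_point) (M : int), d != 0 ->
  on_twist d (legendre l) P -> on_twist d (legendre l) Q ->
  `|log_height P - log_height Q| <= M -> C + M < log_height Q ->
  C + M < log_height (ec_add d (legendre l) P Q) ->
  C + M < log_height (ec_add d (legendre l) P (ec_opp Q)) ->
  independent_points_of_infinite_order d (legendre l) P Q.
Proof.
move=> l0 l1; have [C hC] := log_height_quasi_quadratic l0 l1.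
exists (7 * C) => d P Q M dn; rewrite legendre_cubic => onP onQ hM hQ hS hT.
pose mw A on : mordell_weil dn (legendre_nonsingular l0 l1) :=
  exist _ A (introT (on_twistP _ _ _ _ A) on).
pose P' := mw P onP; pose Q' := mw Q onQ.
apply: (@mw_independent _ _ _ _ dn (legendre_nonsingular l0 l1) P' Q') => m n.
pose h (A : mordell_weil dn (legendre_nonsingular l0 l1)) := log_height (val A).
have hN A : h (- A) = h A by rewrite /h val_mwN /log_height ec_height_opp.
exact: (@quasi_independent _ h C _ hN (hC d dn) P' Q' M m n hM hQ hS hT).
Qed.

(** The value at [(r, s)] of the form with roots the x-coordinates of [A + B] and
    [A - B], when the x-coordinates [p1 / q1] and [p2 / q2] depend on a parameter. *)
Definition xsum_poly (l : rat) (p1 q1 p2 q2 : {poly rat}) (r s : rat) : {poly rat} :=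
  (r ^+ 2)%:P * (p1 * q2 - p2 * q1) ^+ 2
  - (r * s * 2)%:P * ((p1 * q2 + p2 * q1) * (p1 * p2 + l%:P * q1 * q2)
       - (2 * (1 + l))%:P * p1 * p2 * q1 * q2)
  + (s ^+ 2)%:P * (p1 * p2 - l%:P * q1 * q2) ^+ 2.

Lemma horner_xsum_poly l p1 q1 p2 q2 r s w :
  (xsum_poly l p1 q1 p2 q2 r s).[w] =
  r ^+ 2 * xsum_den p1.[w] q1.[w] p2.[w] q2.[w]
  - r * s * xsum_mid l p1.[w] q1.[w] p2.[w] q2.[w]
  + s ^+ 2 * xsum_num l p1.[w] q1.[w] p2.[w] q2.[w].
Proof.
rewrite /xsum_poly /xsum_den /xsum_mid /xsum_num.
by rewrite !(hornerD, hornerN, hornerM, hornerC, horner_exp); ring.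
Qed.

Lemma xsum_poly_root l d (p1 q1 p2 q2 : {poly rat}) w x1 y1 x2 y2 :
  l != 0 -> l != 1 -> d != 0 ->
  let P := Aff x1 y1 in let Q := Aff x2 y2 in
  on_twist d (legendre l) P -> on_twist d (legendre l) Q ->
  x1 * q1.[w] = p1.[w] -> x2 * q2.[w] = p2.[w] ->
  forall S, S = ec_add d (legendre l) P Q \/ S = ec_add d (legendre l) P (ec_opp Q) ->
  (xsum_poly l p1 q1 p2 q2 (proj_x S) (proj_z S)).[w] = 0.
Proof.
move=> l0 l1 dn P Q; rewrite legendre_cubic => onP onQ e1 e2 S eS.
have [k _ [/=]] := xsum l0 l1 dn onP onQ; rewrite -/P -/Q => eD eM eN.
rewrite horner_xsum_poly -e1 -e2.
transitivity ((q1.[w] * q2.[w]) ^+ 2 *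
  (proj_x S ^+ 2 * xsum_den x1 1 x2 1 - proj_x S * proj_z S * xsum_mid l x1 1 x2 1
     + proj_z S ^+ 2 * xsum_num l x1 1 x2 1)).
  by rewrite /xsum_den /xsum_mid /xsum_num; ring.
by rewrite -eD -eM -eN; case: eS => ->; ring.
Qed.

(** The points of bounded height have finitely many x-coordinates. *)
Lemma finite_low_height (K : int) :
  exists s : seq (rat * rat), (forall rs, rs \in s -> rs != (0, 0)) /\
    forall S, log_height S <= K -> (proj_x S, proj_z S) \in s.
Proof.
have [s fs] := finite_height_le K.
exists ((1, 0) :: [seq (x, 1) | x <- s]); split.
  by move=> rs; rewrite inE => /orP[/eqP->|/mapP[x _ ->]] //; rewrite xpair_eqE oner_eq0 andbF.
case=> [|x y] hS; first by rewrite inE eqxx.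
by rewrite inE; apply/orP; right; apply/mapP; exists x => //; apply: fs.
Qed.

(** Two points whose x-coordinates [p1 / q1] and [p2 / q2] are rational functions
    of [w] related by a homography are independent for all but finitely many
    [w], provided that neither the second x-coordinate nor those of the sum and
    difference are constant.  The twist may vary with the points. *)
Lemma independent_outside_finite l (p1 q1 p2 q2 : {poly rat}) (a b c e : rat) :
  l != 0 -> l != 1 -> a * e - b * c != 0 ->
  (forall x, p2 - x%:P * q2 != 0) ->
  (forall r s, (r, s) != (0, 0) -> xsum_poly l p1 q1 p2 q2 r s != 0) ->
  exists W : seq rat, forall w d x1 y1 x2 y2, w \notin W -> d != 0 ->
    on_twist d (legendre l) (Aff x1 y1) -> on_twist d (legendre l) (Aff x2 y2) ->
    x1 * q1.[w] = p1.[w] -> x2 * q2.[w] = p2.[w] ->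
    x1 * (c * x2 + e) = a * x2 + b ->
    independent_points_of_infinite_order d (legendre l) (Aff x1 y1) (Aff x2 y2).
Proof.
move=> l0 l1 det0 nc nx.
have [C hC] := twist_independent l0 l1.
have [M hM] := log_height_moebius det0.
have [s0 fs0] := finite_height_le (C + M).
have [s1 [s1n fs1]] := finite_low_height (C + M).
have fin1 : finite (fun w => exists2 x, x \in s0 & (p2 - x%:P * q2).[w] = 0).
  by apply: finite_bind => [|x]; [exists s0 | exact: finite_roots (nc x)].
have fin2 : finite (fun w => exists2 rs, rs \in s1 &
    (xsum_poly l p1 q1 p2 q2 rs.1 rs.2).[w] = 0 /\ rs != (0, 0)).
  apply: finite_bind => [|[r s]]; first by exists s1.
  have [|/nx n0] := eqVneq (r, s) (0, 0); first by move=> e0; exists [::] => w [].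
  by apply: finite_sub (finite_roots n0) => w [].
have [W fW] := finite_or fin1 fin2.
exists W => w d x1 y1 x2 y2 wW dn onP onQ e1 e2 em.
have root := xsum_poly_root l0 l1 dn onP onQ e1 e2.
have low S : S = ec_add d (legendre l) (Aff x1 y1) (Aff x2 y2) \/
    S = ec_add d (legendre l) (Aff x1 y1) (ec_opp (Aff x2 y2)) ->
    log_height S <= C + M ->
    exists2 rs, rs \in s1 & (xsum_poly l p1 q1 p2 q2 rs.1 rs.2).[w] = 0 /\ rs != (0, 0).
  move=> /root eS /fs1 inS; exists (proj_x S, proj_z S) => //.
  by split=> //; apply: s1n.
have [hQ|hQ] := lerP (log_height (Aff x2 y2)) (C + M).
  case/negP: wW; apply: fW; left; exists x2; first exact: fs0.
  by rewrite hornerD hornerN hornerM hornerC e2 subrr.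
have [hS|hS] := lerP (log_height (ec_add d (legendre l) (Aff x1 y1) (Aff x2 y2))) (C + M).
  by case/negP: wW; apply: fW; right; apply: low hS; left.
have [hT|hT] := lerP (log_height (ec_add d (legendre l) (Aff x1 y1) (ec_opp (Aff x2 y2)))) (C + M).
  by case/negP: wW; apply: fW; right; apply: low hT; right.
by apply: hC hQ hS hT => //; exact: hM em.
Qed.

(** * The two Legendre curves *)

Section SpecialValues.
Variables l p1 q1 p2 q2 r s : rat.

(** When a coordinate vanishes, one of the two points is at infinity or of order
    2, so [P + Q] and [P - Q] have the same x-coordinate and the form is a
    square. *)
Definition xsum_form :=
  r ^+ 2 * xsum_den p1 q1 p2 q2 - r * s * xsum_mid l p1 q1 p2 q2
  + s ^+ 2 * xsum_num l p1 q1 p2 q2.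

Lemma xsum_form_p1_0 : p1 = 0 -> xsum_form = (q1 * (p2 * r - l * q2 * s)) ^+ 2.
Proof.
by move=> e; rewrite /xsum_form /xsum_den /xsum_mid /xsum_num e; ring.
Qed.

Lemma xsum_form_q1_0 : q1 = 0 -> xsum_form = (p1 * (q2 * r - p2 * s)) ^+ 2.
Proof.
by move=> e; rewrite /xsum_form /xsum_den /xsum_mid /xsum_num e; ring.
Qed.

Lemma xsum_form_p2_0 : p2 = 0 -> xsum_form = (q2 * (p1 * r - l * q1 * s)) ^+ 2.
Proof.
by move=> e; rewrite /xsum_form /xsum_den /xsum_mid /xsum_num e; ring.
Qed.

Lemma xsum_form_q2_0 : q2 = 0 -> xsum_form = (p2 * (q1 * r - p1 * s)) ^+ 2.
Proof.
by move=> e; rewrite /xsum_form /xsum_den /xsum_mid /xsum_num e; ring.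
Qed.
End SpecialValues.

Section Family.
Variable a : rat.
Hypotheses (a_neq0 : a != 0) (a_neq1 : a != 1) (a_neqN1 : a != -1).

Let B := (a ^+ 2 - 1) ^+ 2.
Let G := (a ^+ 2 + 1) ^+ 2.

Lemma am_neq0 : a ^+ 2 - 1 != 0.
Proof.
rewrite (_ : _ - 1 = (a - 1) * (a + 1)); last by ring.
by rewrite mulf_neq0 ?subr_eq0 // addr_eq0.
Qed.

Lemma am'_neq0 : -1 + a ^+ 2 != 0.
Proof. by rewrite addrC am_neq0. Qed.

Lemma ap_neq0 : a ^+ 2 + 1 != 0.
Proof. by rewrite lt0r_neq0 // ltr_wpDl ?sqr_ge0. Qed.

Let B_neq0 : B != 0. Proof. by rewrite expf_neq0 ?am_neq0. Qed.
Let G_neq0 : G != 0. Proof. by rewrite expf_neq0 ?ap_neq0. Qed.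

(** The x-coordinates of the points depend on [t] only through [parameter t]. *)
Definition parameter (t : rat) := t ^+ 2 + 4 / t ^+ 2.

(** The x-coordinate [P0], as a quotient of polynomials in [parameter t]. *)
Definition P0_num : {poly rat} := - (B%:P * 'X + (4 * G)%:P).
Definition P0_den : {poly rat} := (4 * a ^+ 2)%:P * 'X - (4 * G)%:P.

Lemma on_twist_legendre d l x y :
  on_twist d (legendre l) (Aff x y) <-> d * y ^+ 2 = x * (x - 1) * (x - l).
Proof. by rewrite /= /legendre !(hornerM, hornerD, hornerN, hornerX, hornerC). Qed.

Section Point.
Variables t u : rat.
Hypotheses (t_neq0 : t != 0) (u_neq0 : u != 0) (tu : u ^+ 2 = quartic a t).

(* The second factor of g, up to sign also the numerator of P0. *)
Let N := B * t ^+ 4 + 4 * G * t ^+ 2 + 4 * B.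

Lemma g_eq : g a t = - (t ^+ 4 + 4) * N * u ^+ 2.
Proof. by rewrite tu /g /N /B /G; ring. Qed.

Lemma t2_gt0 : 0 < t ^+ 2.
Proof. by rewrite lt0r sqr_ge0 expf_neq0. Qed.
Lemma t4_ge0 : 0 <= t ^+ 4.
Proof. by rewrite (exprM t 2 2) sqr_ge0. Qed.

Lemma g_neq0 : g a t != 0.
Proof.
have [t2 t4] := (t2_gt0, t4_ge0).
have B0 : 0 < B by rewrite lt0r B_neq0 sqr_ge0.
have G0 : 0 < G by rewrite lt0r G_neq0 sqr_ge0.
have N0 : 0 < N.
  have := mulr_ge0 (ltW B0) t4; have := mulr_gt0 G0 t2; rewrite /N; lra.
rewrite g_eq !mulf_neq0 ?expf_neq0 //; first by rewrite oppr_eq0 lt0r_neq0 //; lra.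
by rewrite lt0r_neq0.
Qed.

Lemma P0E : P0 a t u = - (N / (4 * u ^+ 2)).
Proof. by rewrite /P0 /N /B /G; congr (- (_ * _)); ring. Qed.

Lemma P0_sub1 : P0 a t u - 1 = - (G * (t ^+ 4 + 4) / (4 * u ^+ 2)).
Proof.
have -> : G * (t ^+ 4 + 4) = N + 4 * u ^+ 2 by rewrite tu /quartic /N /B /G; ring.
by rewrite P0E; field.
Qed.

Lemma P0_lambda1 :
  P0 a t u - lambda1 a = - (G ^+ 2 * (t ^+ 2 - 2) ^+ 2 / (4 * B * u ^+ 2)).
Proof.
have -> : G ^+ 2 * (t ^+ 2 - 2) ^+ 2 = B * N + 4 * (B + G) * u ^+ 2.
  by rewrite tu /quartic /N /B /G; ring.
have -> : lambda1 a = (B + G) / B.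
  rewrite /lambda1 (_ : (-1 + a ^+ 2) ^+ 2 = B); last by rewrite /B; ring.
  by congr (_ / _); rewrite /B /G; ring.
by rewrite P0E; field; rewrite u_neq0 B_neq0.
Qed.

Lemma P0_lambda2 :
  P0 a t u - lambda2 a = - (G ^+ 2 * t ^+ 2 / (4 * a ^+ 2 * u ^+ 2)).
Proof.
have -> : G ^+ 2 * t ^+ 2 = a ^+ 2 * N - B * u ^+ 2.
  by rewrite tu /quartic /N /B /G; ring.
rewrite /lambda2 (_ : (-1 + a ^+ 2) ^+ 2 = B); last by rewrite /B; ring.
by rewrite P0E; field; rewrite u_neq0.
Qed.

Lemma t22_neq0 : t ^+ 2 + 2 != 0.
Proof. by rewrite lt0r_neq0 //; have := t2_gt0; lra. Qed.

Lemma on_P1 : on_twist (g a t) (E1 a) (P1 a t u).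
Proof.
apply/on_twist_legendre; rewrite P0_lambda1 P0_sub1 P0E g_eq /B /G.
by field; rewrite ?u_neq0 ?t_neq0 ?a_neq0 ?am_neq0 ?am'_neq0 ?t22_neq0.
Qed.

Lemma on_P2 : on_twist (g a t) (E2 a) (P2 a t u).
Proof.
apply/on_twist_legendre; rewrite P0_lambda2 P0_sub1 P0E g_eq /G.
by field; rewrite ?u_neq0 ?t_neq0 ?a_neq0 ?am_neq0 ?am'_neq0 ?t22_neq0.
Qed.

Lemma on_Q1 : on_twist (g a t) (E1 a) (Q1 a t u).
Proof.
apply/on_twist_legendre; rewrite g_eq /N /B /G /lambda1.
by field; rewrite ?u_neq0 ?t_neq0 ?a_neq0 ?am_neq0 ?am'_neq0 ?t22_neq0.
Qed.

Lemma on_Q2 : on_twist (g a t) (E2 a) (Q2 a t u).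
Proof.
apply/on_twist_legendre; rewrite g_eq /N /B /G /lambda2.
by field; rewrite ?u_neq0 ?t_neq0 ?a_neq0 ?am_neq0 ?am'_neq0 ?t22_neq0.
Qed.

Lemma P0_parameter :
  P0 a t u * P0_den.[parameter t] = P0_num.[parameter t].
Proof.
rewrite /P0_den /P0_num !(hornerM, hornerD, hornerN, hornerX, hornerC).
have -> : 4 * a ^+ 2 * parameter t - 4 * G = 4 * u ^+ 2 / t ^+ 2.
  by rewrite tu /parameter /quartic /G; field.
by rewrite P0E /parameter /N; field; rewrite u_neq0 t_neq0.
Qed.
End Point.

Lemma horner_P0_num w : P0_num.[w] = - (B * w + 4 * G).
Proof. by rewrite !(hornerM, hornerD, hornerN, hornerX, hornerC). Qed.

Lemma horner_P0_den w : P0_den.[w] = 4 * a ^+ 2 * w - 4 * G.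
Proof. by rewrite !(hornerM, hornerD, hornerN, hornerX, hornerC). Qed.

Let GB : 4 * a ^+ 2 = G - B. Proof. by rewrite /B /G; ring. Qed.
Let BG_neq0 : B + G != 0.
Proof.
by rewrite lt0r_neq0 // ltr_pwDl ?sqr_ge0 // lt0r B_neq0 sqr_ge0.
Qed.

Lemma E1_xsum_poly_neq0 (r s : rat) : (r, s) != (0, 0) ->
  xsum_poly (lambda1 a) P0_num P0_den (4%:P - 'X) 4%:P r s != 0.
Proof.
move=> rs0; apply/eqP=> e0; case/eqP: rs0.
have form0 w : xsum_form (lambda1 a) (- (B * w + 4 * G)) (4 * a ^+ 2 * w - 4 * G)
    (4 - w) 4 r s = 0.
  have := congr1 (horner^~ w) e0.
  by rewrite horner_xsum_poly horner_P0_num horner_P0_den hornerD hornerN hornerX !hornerC.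
have lB : lambda1 a * B = B + G.
  by rewrite /lambda1 /B /G; field; rewrite am'_neq0.
(* At w = 4 the x-coordinates of P and Q are lambda1 and 0; they are those of
   two points of order 2, whose sum is (1, 0). *)
have rs : r = s.
  move/eqP: (form0 4); rewrite xsum_form_p2_0 ?subrr // expf_eq0 /= mulf_eq0 /=.
  have -> : - (B * 4 + 4 * G) * r - lambda1 a * (4 * a ^+ 2 * 4 - 4 * G) * s
     = 4 * (lambda1 a * B * s - (B + G) * r) by rewrite GB; ring.
  rewrite lB -mulrBr !mulf_eq0 (negPf BG_neq0) /= subr_eq0.
  by move/eqP.
(* At w = G / a^2 the point P is at infinity, so P + Q has the x-coordinate
   of Q, which is not 1. *)
move/eqP: (form0 (G / a ^+ 2)).
rewrite xsum_form_q1_0; last by field.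
rewrite expf_eq0 /= mulf_eq0 => /orP[|].
  have nz : G ^+ 2 / a ^+ 2 != 0 by apply: mulf_neq0; rewrite ?invr_eq0; apply: expf_neq0.
  have -> : - (B * (G / a ^+ 2) + 4 * G) = - (G ^+ 2 / a ^+ 2).
    by rewrite (_ : G ^+ 2 = (B + 4 * a ^+ 2) * G); [field | rewrite GB; ring].
  by rewrite oppr_eq0 (negPf nz).
have nz : G / a ^+ 2 != 0 by apply: mulf_neq0 => //; rewrite invr_eq0; apply: expf_neq0.
rewrite rs (_ : _ - _ = G / a ^+ 2 * s); last by ring.
by rewrite mulf_eq0 (negPf nz) /= => /eqP->.
Qed.

Lemma E1_independent : exists W : seq rat, forall t u : rat,
  t != 0 -> u != 0 -> u ^+ 2 = quartic a t -> parameter t \notin W ->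
  independent_points_of_infinite_order (g a t) (E1 a) (P1 a t u) (Q1 a t u).
Proof.
have /andP[l0 l1] := lambda1_neq01 a_neq1 a_neqN1.
have [|||W hW] := @independent_outside_finite (lambda1 a) P0_num P0_den
  (4%:P - 'X) 4%:P B (- (B + G)) (- (4 * a ^+ 2)) (- B) l0 l1.
- have -> : B * (- B) - (- (B + G)) * - (4 * a ^+ 2) = - G ^+ 2.
    by rewrite GB; ring.
  by rewrite oppr_eq0 expf_neq0.
- move=> x; apply/eqP=> /(congr1 (fun p => p.[5 - 4 * x])).
  rewrite !(hornerM, hornerD, hornerN, hornerX, hornerC, horner0).
  have -> : 4 - (5 - 4 * x) - x * 4 = -1 by ring.
  by move=> h; have := oner_neq0 rat; rewrite -oppr_eq0 h eqxx.
- exact: E1_xsum_poly_neq0.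
exists W => t u t0 u0 tu tW.
apply: (hW _ _ _ _ _ _ tW).
- exact: g_neq0 tu.
- exact: on_P1.
- exact: on_Q1.
- exact: P0_parameter.
- rewrite !(hornerD, hornerN, hornerX, hornerC) /parameter; field; rewrite t0 //.
have -> : - (4 * a ^+ 2) * - ((t ^+ 2 - 2) ^+ 2 / (4 * t ^+ 2)) - B = u ^+ 2 / t ^+ 2.
  by rewrite tu /quartic /B; field.
by rewrite P0E //; rewrite /B /G; field; rewrite t0 u0.
Qed.

Lemma E2_xsum_poly_neq0 (r s : rat) : (r, s) != (0, 0) ->
  xsum_poly (lambda2 a) P0_num P0_den 4%:P ('X + 4%:P) r s != 0.
Proof.
move=> rs0; apply/eqP=> e0; case/eqP: rs0.
have form0 w : xsum_form (lambda2 a) (- (B * w + 4 * G)) (4 * a ^+ 2 * w - 4 * G)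
    4 (w + 4) r s = 0.
  have := congr1 (horner^~ w) e0.
  by rewrite horner_xsum_poly horner_P0_num horner_P0_den hornerD hornerX !hornerC.
have la : lambda2 a * (4 * a ^+ 2) = - B.
  by rewrite /lambda2 /B; field.
(* At w = - 4 G / B the x-coordinates of P and Q are 0 and lambda2; they are
   those of two points of order 2, whose sum is (1, 0). *)
have rs : r = s.
  move/eqP: (form0 (- (4 * G / B))); rewrite xsum_form_p1_0; last by field.
  have -> : - (4 * G / B) + 4 = - 4 * (4 * a ^+ 2) / B by rewrite GB; field.
  rewrite expf_eq0 /= mulf_eq0 => /orP[|].
    have nz : - 4 * G ^+ 2 / B != 0.
      apply: mulf_neq0; last by rewrite invr_eq0.
      by apply: mulf_neq0 => //; apply: expf_neq0.
    by rewrite (_ : _ - _ = - 4 * G ^+ 2 / B) ?(negPf nz) // GB; field.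
  rewrite (_ : _ - _ = 4 * (r - s)); first by rewrite mulf_eq0 subr_eq0 => /eqP.
  transitivity (4 * r + 4 * (lambda2 a * (4 * a ^+ 2)) / B * s); first by ring.
  by rewrite la; field.
(* At w = - 4 the point Q is at infinity, so P + Q has the x-coordinate of P,
   which is not 1. *)
move/eqP: (form0 (- 4)); rewrite xsum_form_q2_0; last by ring.
rewrite expf_eq0 /= mulf_eq0 /= rs.
have -> : (4 * a ^+ 2 * - 4 - 4 * G) * s - - (B * - 4 + 4 * G) * s = - 4 * G * s.
  by rewrite GB; ring.
have nz : - 4 * G != 0 by apply: mulf_neq0.
by rewrite mulf_eq0 (negPf nz) /= => /eqP ->.
Qed.

Lemma E2_independent : exists W : seq rat, forall t u : rat,
  t != 0 -> u != 0 -> u ^+ 2 = quartic a t -> parameter t \notin W ->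
  independent_points_of_infinite_order (g a t) (E2 a) (P2 a t u) (Q2 a t u).
Proof.
have /andP[l0 l1] := lambda2_neq01 a_neq0 a_neq1 a_neqN1.
have [|||W hW] := @independent_outside_finite (lambda2 a) P0_num P0_den
  4%:P ('X + 4%:P) (- (4 * a ^+ 2)) (- B) (- (4 * a ^+ 2 + G)) (4 * a ^+ 2) l0 l1.
- have -> : - (4 * a ^+ 2) * (4 * a ^+ 2) - - B * - (4 * a ^+ 2 + G) = - G ^+ 2.
    by rewrite GB; ring.
  by rewrite oppr_eq0 expf_neq0.
- move=> x; apply/eqP=> /(congr1 (fun p => p.[- 4])).
  rewrite !(hornerM, hornerD, hornerN, hornerX, hornerC, horner0).
  by rewrite addNr mulr0 subr0.
- exact: E2_xsum_poly_neq0.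
exists W => t u t0 u0 tu tW.
have t2 := t22_neq0 t0.
apply: (hW _ _ _ _ _ _ tW).
- exact: g_neq0 tu.
- exact: on_P2.
- exact: on_Q2.
- exact: P0_parameter.
- by rewrite !(hornerD, hornerX, hornerC) /parameter; field; rewrite t0 t2.
have -> : - (4 * a ^+ 2 + G) * (4 * t ^+ 2 / (t ^+ 2 + 2) ^+ 2) + 4 * a ^+ 2
   = 4 * u ^+ 2 / (t ^+ 2 + 2) ^+ 2.
  by rewrite tu /quartic /G; field.
by rewrite P0E //; rewrite /B /G; field; rewrite u0 t2.
Qed.
End Family.

(** * The points of the quartic *)

Lemma finite_quartic_points a (W : seq rat) : a != 0 ->
  exists s : seq (rat * rat), forall t u, u ^+ 2 = quartic a t ->
    (t, u) \notin s -> [/\ t != 0, u != 0 & parameter t \notin W].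
Proof.
move=> a0.
have fin_q : finite (fun t => quartic a t = 0).
  pose p := (a ^+ 2)%:P * 'X^4 - ((a ^+ 2 + 1) ^+ 2)%:P * 'X^2 + (4 * a ^+ 2)%:P.
  have pE t : p.[t] = quartic a t.
    by rewrite /quartic !(hornerXn, hornerD, hornerN, hornerM, hornerC).
  have p0 : p != 0.
    apply/eqP=> e; have := pE 0; rewrite e horner0 /quartic !expr0n /= !mulr0 subr0 add0r.
    by move/eqP; rewrite eq_sym !mulf_eq0 (negPf a0).
  by apply: finite_sub (finite_roots p0) => t; rewrite pE.
(* For t != 0, this equation states that parameter t = w. *)
have fin_w : finite (fun t => exists2 w, w \in W & t ^+ 4 - w * t ^+ 2 + 4 = 0).
  apply: finite_bind => [|w]; first by exists W.
  pose p : {poly rat} := 'X^4 - w%:P * 'X^2 + 4%:P.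
  have pE t : p.[t] = t ^+ 4 - w * t ^+ 2 + 4.
    by rewrite !(hornerXn, hornerD, hornerN, hornerM, hornerC).
  have p0 : p != 0.
    by apply/eqP=> e; have := pE 0; rewrite e horner0 !expr0n /= mulr0 subr0 add0r.
  by apply: finite_sub (finite_roots p0) => t; rewrite pE.
have fin_0 : finite (fun t : rat => t = 0) by exists [:: 0] => t ->; rewrite mem_head.
have fin_u t : finite (fun tu : rat * rat => tu.1 = t /\ tu.2 ^+ 2 = quartic a t).
  pose p : {poly rat} := 'X^2 - (quartic a t)%:P.
  have p0 : p != 0 by rewrite -size_poly_eq0 size_XnsubC.
  have [s fs] := finite_roots p0; exists [seq (t, u) | u <- s] => -[t' u] [/= -> e].
  apply/mapP; exists u => //; apply: fs.
  by rewrite !(hornerXn, hornerD, hornerN, hornerC) e subrr.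
have [s fs] := finite_bind (finite_or fin_0 (finite_or fin_q fin_w)) fin_u.
exists s => t u tu /negP nts.
have t0 : t != 0.
  by apply/eqP=> t0; apply: nts; apply: fs; exists t => //; left.
split=> //.
  apply/eqP=> u0; apply: nts; apply: fs; exists t => //; right; left.
  by rewrite -tu u0 expr0n.
apply/negP=> tW; apply: nts; apply: fs; exists t => //; right; right.
by exists (parameter t) => //; rewrite /parameter; field.
Qed.

Theorem theorem5p3 (a : rat) (a_neq0 : a != 0) (a_neq1 : a != 1)
    (a_neqN1 : a != -1) :
  (exists s : seq (rat * rat), forall t u : rat,
     u ^+ 2 = quartic a t -> (t, u) \notin s ->
     [/\ g a t != 0, rank_ge (g a t) (E1 a) 2 & rank_ge (g a t) (E2 a) 2])
  /\
  (exists s : seq (rat * rat), forall t u : rat,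
     u ^+ 2 = quartic a t -> (t, u) \notin s ->
     [/\ g a t != 0,
         independent_points_of_infinite_order (g a t) (E1 a)
           (P1 a t u) (Q1 a t u)
       & independent_points_of_infinite_order (g a t) (E2 a)
           (P2 a t u) (Q2 a t u)]).
Proof.
have [W1 indep1] := E1_independent a_neq0 a_neq1 a_neqN1.
have [W2 indep2] := E2_independent a_neq0 a_neq1 a_neqN1.
have [s good] := finite_quartic_points (W1 ++ W2) a_neq0.
have points t u : u ^+ 2 = quartic a t -> (t, u) \notin s ->
     [/\ g a t != 0,
         independent_points_of_infinite_order (g a t) (E1 a)
           (P1 a t u) (Q1 a t u)
       & independent_points_of_infinite_order (g a t) (E2 a)
           (P2 a t u) (Q2 a t u)].
  move=> tu /(good _ _ tu)[t0 u0]; rewrite mem_cat => /norP[w1 w2].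
  split; [exact: g_neq0 tu | exact: indep1 | exact: indep2].
have rank2 f d P Q : independent_points_of_infinite_order d f P Q -> rank_ge d f 2.
  case=> onP onQ _ _ ind; exists [tuple P; Q]; split=> // i.
  by case: i => -[|[|//]] lti; rewrite (tnth_nth Inf).
split; exists s => // t u tu /(points _ _ tu)[g0 i1 i2].
by split=> //; [apply: rank2 i1 | apply: rank2 i2].
Qed.
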